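(* Let $m$ and $n$ be positive integers with $m\geq 5$. Suppose that $G\cong K_m$ and $H\cong K_n$ are disjointly embedded, weakly linked graphs in $\mathbb{R}^3$, and $T_1$ and $T_2$ are (oriented) triangles in $H$ linking $G$ in stars $\Sigma_1=p_1O_1I_1$ and $\Sigma_2=p_2O_2I_2$, respectively, which have no common apex. Then (after possibly re-orienting $T_1$ and $T_2$ so that $\Sigma_1$ and $\Sigma_2$ are mutually oriented) precisely one of the following holds: (C1) There is a vertex $p_3$ distinct from $p_1,p_2$ such that $I_1=\{p_3\}$ and $O_2=\{p_1,p_3\}$. (C2) There is a vertex $p_3$ distinct from $p_1,p_2$ such that $I_2=\{p_3\}$ and $O_1=\{p_2,p_3\}$. (C3) There is a vertex $p_3$ distinct from $p_1,p_2$ such that $O_1=\{p_2,p_3\}$ and $O_2=\{p_1,p_3\}$. Thus, disregarding orientations, $\Sigma_1\cup\Sigma_2$ consists of all triangles of $G$ sharing an edge with $T^*=p_1p_2p_3$, with the sole exception of $T^*$ itself in case (C3).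
   Context: An embedded graph is identified with its image in $\mathbb{R}^3$. $\operatorname{Lk}(C,D)$ denotes the linking number of disjoint oriented simple closed curves; $C,D$ are linked if $\operatorname{Lk}(C,D)\neq 0$ and strongly linked if $|\operatorname{Lk}(C,D)|\geq 2$. Disjointly embedded graphs are weakly linked if some cycle in one links a cycle in the other, but no cycle in one strongly links a cycle in the other. For distinct vertices $p,q,r$, $pqr$ denotes the oriented triangle $p\to q\to r\to p$, and $-T$ is $T$ reversed. Star: given an ordered partition $(\{p\},O,I)$ of the vertices of $K_m$ into nonempty sets, the star $pOI$ consists of all oriented triangles $pqr$ with $q\in O$, $r\in I$. The same star may have several such expressions: $p\{q\}I=qI\{p\}$. We put $-(pOI)=pIO$. An oriented curve $C$ links $K_m$ in the star $pOI$ if for all oriented triangles $T$ of $K_m$: $\operatorname{Lk}(C,T)=+1$ if $T\in pOI$, $-1$ if $-T\in pOI$, and $0$ otherwise. Reversing the orientation of $C$ replaces the star by its negative, i.e. swaps $O$ and $I$. Two stars $\Sigma_1=p_1O_1I_1$, $\Sigma_2=p_2O_2I_2$ with $p_1\neq p_2$ are mutually oriented if $p_1\in O_2$ and $p_2\in O_1$. Stars $\Sigma_1,\Sigma_2$ have a common apex if there is a vertex $p$ such that each can be expressed in the form $\Sigma_i=pO_i'I_i'$; otherwise they have no common apex. *)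

(* Defs.v *)
From HB Require Import structures.
From mathcomp Require Import all_boot all_order all_algebra.
From mathcomp Require Import all_classical all_reals all_analysis.
Set Implicit Arguments.
Unset Strict Implicit.
Unset Printing Implicit Defensive.
Import Order.TTheory GRing.Theory Num.Theory.
Import numFieldNormedType.Exports.
Local Open Scope classical_set_scope.
Local Open Scope ring_scope.

(** * Linking number *)

Definition dot3 {R : realType} (u v : 'rV[R]_3) : R := (u *m v^T) 0 0.

Definition norm3 {R : realType} (u : 'rV[R]_3) : R := Num.sqrt (dot3 u u).

Definition det3 {R : realType} (u v w : 'rV[R]_3) : R :=
  \det (\matrix_(i < 3) [:: u; v; w]`_i).

(** Signed solid angle at the origin of the triangle with corners u, v, w
    (van Oosterom-Strackee formula).  With atan it is valid when the
    denominator is positive, in particular when the directions of u, v, w are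
    pairwise at an angle less than pi / 2. *)
Definition solid_angle {R : realType} (u v w : 'rV[R]_3) : R :=
  2 * atan (det3 u v w /
    (norm3 u * norm3 v * norm3 w
     + dot3 u v * norm3 w + dot3 v w * norm3 u + dot3 w u * norm3 v)).

(** The torus [0,1]^2 is cut into N^2 squares, and each square into two
    triangles; this is the signed area, divided by the area of the sphere, of
    the corresponding geodesic triangulation approximating the Gauss map
    (s, t) |-> (d t - c s) / |d t - c s|. *)
Definition lk_grid {R : realType} (c d : R -> 'rV[R]_3) (N : nat) : R :=
  let v i j := d (j%:R / N%:R) - c (i%:R / N%:R) in
  (4 * pi)^-1 * \sum_(i < N) \sum_(j < N)
    (solid_angle (v i j) (v i.+1 j) (v i.+1 j.+1)
     + solid_angle (v i j) (v i.+1 j.+1) (v i j.+1)).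

(** Linking number of two disjoint closed curves parametrised by [0,1]: the
    degree of their Gauss map from the torus to the sphere.  For continuous
    disjoint closed curves the sequence [lk_grid c d] is eventually constant
    and equal to that degree; for C^1 curves the degree is the Gauss linking
    integral.  No smoothness or tameness is needed. *)
Definition lk {R : realType} (c d : R -> 'rV[R]_3) : R :=
  lim (lk_grid c d @ \oo).

Definition linked {R : realType} (c d : R -> 'rV[R]_3) : Prop := lk c d != 0.

Definition strongly_linked {R : realType} (c d : R -> 'rV[R]_3) : Prop :=
  2 <= `|lk c d|.

(** * Embedded complete graphs *)

(** The vertices of K_m are the elements of 'I_m; K_m is realised as the
    1-skeleton of the standard simplex in R^m. *)
Definition edge_point {R : realType} {m : nat} (u v : 'I_m) (t : R) : 'rV[R]_m :=
  (1 - t) *: delta_mx 0 u + t *: delta_mx 0 v.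

Definition complete_graph (R : realType) (m : nat) : set 'rV[R]_m :=
  [set x | exists u v t, 0 <= t <= 1 /\ x = edge_point u v t].
Arguments complete_graph : clear implicits.

(** Since the realisation is compact, a continuous injective map is a
    homeomorphism onto its image. *)
Definition graph_embedding {R : realType} {m : nat}
    (f : 'rV[R]_m -> 'rV[R]_3) : Prop :=
  {within complete_graph R m, continuous f}
  /\ {in complete_graph R m &, injective f}.

Definition disjointly_embedded {R : realType} {m n : nat}
    (f : 'rV[R]_m -> 'rV[R]_3) (g : 'rV[R]_n -> 'rV[R]_3) : Prop :=
  [/\ graph_embedding f, graph_embedding g
    & f @` complete_graph R m `&` g @` complete_graph R n = set0].

(** The oriented cycle s_0 -> s_1 -> ... -> s_(k-1) -> s_0 of K_m is the
    sequence s of its vertices. *)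
Definition is_cycle {m : nat} (s : seq 'I_m) : bool := uniq s && (2 < size s)%N.

(** Its image under f, parametrised by [0,1], each edge taking time
    [1 / size s]. *)
Definition cycle_curve {R : realType} {m : nat} (f : 'rV[R]_m -> 'rV[R]_3)
    (s : seq 'I_m) (t : R) : 'rV[R]_3 :=
  let k := size s in
  let x := k%:R * t in
  let i := Num.truncn x in
  let vtx j : 'rV[R]_m := [seq delta_mx 0 p | p <- s]`_(j %% k)%N in
  f ((1 - (x - i%:R)) *: vtx i + (x - i%:R) *: vtx i.+1).

Definition weakly_linked {R : realType} {m n : nat}
    (f : 'rV[R]_m -> 'rV[R]_3) (g : 'rV[R]_n -> 'rV[R]_3) : Prop :=
  (exists (s : seq 'I_m) (t : seq 'I_n),
     [/\ is_cycle s, is_cycle t & linked (cycle_curve f s) (cycle_curve g t)])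
  /\ (forall (s : seq 'I_m) (t : seq 'I_n), is_cycle s -> is_cycle t ->
        ~ strongly_linked (cycle_curve f s) (cycle_curve g t)).

(** * Stars *)

(** The triple (a, b, c) of distinct vertices represents the oriented triangle
    a -> b -> c -> a, so that cyclic rotations represent the same oriented
    triangle and [rev] reverses the orientation. *)
Notation triple m := (3.-tuple 'I_m).

Definition flip {m : nat} (T : triple m) : triple m := [tuple of rev T].

Definition ordered_partition {m : nat} (p : 'I_m) (O I : {set 'I_m}) : bool :=
  [&& O != finset.set0, I != finset.set0, [disjoint O & I]
    & (O :|: I)%SET == [set~ p]%SET].

(** The set of all triples representing an oriented triangle in pOI. *)
Definition star {m : nat} (p : 'I_m) (O I : {set 'I_m}) : {set triple m} :=
  [set T : triple m | [exists q in O, exists r in I, exists k : 'I_3,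
     rot k T == [:: p; q; r]]]%SET.

Definition links_in_star {R : realType} {m : nat} (c : R -> 'rV[R]_3)
    (f : 'rV[R]_m -> 'rV[R]_3) (S : {set triple m}) : Prop :=
  forall T : triple m, uniq T ->
    lk c (cycle_curve f T)
    = if T \in S then 1 else if flip T \in S then -1 else 0.

Definition mutually_oriented {m : nat} (p1 : 'I_m) (O1 : {set 'I_m})
    (p2 : 'I_m) (O2 : {set 'I_m}) : Prop :=
  [/\ p1 != p2, p1 \in O2 & p2 \in O1].

Definition common_apex {m : nat} (S1 S2 : {set triple m}) : Prop :=
  exists (p : 'I_m) (O1 I1 O2 I2 : {set 'I_m}),
    [/\ ordered_partition p O1 I1, ordered_partition p O2 I2,
        S1 = star p O1 I1 & S2 = star p O2 I2].

(** Triangles without orientation are identified with their vertex sets. *)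
Definition unoriented {m : nat} (S : {set triple m}) : {set {set 'I_m}} :=
  [set [set x in (T : triple m)] | T in S]%SET.

Definition triangles_sharing_edge {m : nat} (t0 : {set 'I_m}) : {set {set 'I_m}} :=
  [set t : {set 'I_m} | (#|t| == 3)%N &&
     [exists u, exists v, [&& u != v, [set u; v] \subset t
                                    & [set u; v] \subset t0]]]%SET.

(** * The three cases *)

Definition C1 {m : nat} (p1 : 'I_m) (O1 I1 : {set 'I_m})
    (p2 : 'I_m) (O2 I2 : {set 'I_m}) (p3 : 'I_m) : Prop :=
  [/\ p3 != p1, p3 != p2, I1 = [set p3]%SET & O2 = [set p1; p3]%SET].

Definition C2 {m : nat} (p1 : 'I_m) (O1 I1 : {set 'I_m})
    (p2 : 'I_m) (O2 I2 : {set 'I_m}) (p3 : 'I_m) : Prop :=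
  [/\ p3 != p1, p3 != p2, I2 = [set p3]%SET & O1 = [set p2; p3]%SET].

Definition C3 {m : nat} (p1 : 'I_m) (O1 I1 : {set 'I_m})
    (p2 : 'I_m) (O2 I2 : {set 'I_m}) (p3 : 'I_m) : Prop :=
  [/\ p3 != p1, p3 != p2, O1 = [set p2; p3]%SET & O2 = [set p1; p3]%SET].

Definition exactly_one (A B C : Prop) : Prop :=
  [\/ [/\ A, ~ B & ~ C], [/\ ~ A, B & ~ C] | [/\ ~ A, ~ B & C]].

(* Main.v *)
(** The Gauss map of a pair of closed curves has a degree because the solid angle
    of a geodesic triangle is a 2-cocycle: writing unit vectors as spinors, half
    the solid angle of u, v, w is, modulo 2 pi, the sum of the phases of the
    three overlaps <u|v>, <v|w>, <w|u>.  Hence the sum over a closed grid lies in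
    4 pi Z, and it is invariant under refinement.  Cutting cycles of graphs into
    edges then shows that the linking number is an integral bilinear form on the
    cycles of the two graphs.

    For two different triangles T1, T2 of H, with linking functionals A and B,
    there is a functional X, zero or induced by a cycle of H, such that X, X + A,
    X + B and X + A + B are all of this kind, so that each takes only the values
    -1, 0, 1 on the cycles
    of G.  A vertex of G other than the apices p1, p2 has one of four types,
    according to the side of each star on which it lies; six small combinations
    of types contradict these bounds by parity, and the remaining ones without
    common apex are exactly the three cases. *)

Require Import Defs.
From mathcomp Require Import all_boot all_order all_algebra.
From mathcomp Require Import all_classical all_reals all_analysis.
From mathcomp Require Import ring lra zify.
Import Order.TTheory GRing.Theory Num.Theory.
Local Open Scope ring_scope.

Set Implicit Arguments.
Unset Strict Implicit.
Unset Printing Implicit Defensive.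

(** * Angles modulo 2 pi *)

(** Arithmetic modulo 2 pi takes the place of degree theory. Phases only show that the alternating
    sum of solid angles over four pairwise acute vectors is a multiple of 4 pi; the range of atan
    keeps it below 4 pi in absolute value, so the cocycle relation is exact, and this exactness is
    what lets grids be refined. The contribution of a single pair of edges is merely a real number,
    since edges are not closed. The combinatorics argues by parity and wants an integer for every
    pair of edges, which the cones of [integral_form] supply. After [linking_form] no geometry
    remains: only antisymmetry, closed sums and the bound 1 are used. Four functionals are taken
    because together they determine X on many cycles: A = B = 1 forces X = -1, while A = 1 and B =
    -1 force X = 0. In each obstruction some cycles with forced values cover every edge an even
    number of times, although an odd number of these values are -1. *)

Definition mod2pi {R : realType} (x : R) : Prop := exists k : int, x = k%:~R * (2 * pi).

Lemma mod2pi0 (R : realType) : mod2pi (0 : R).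
Proof. by exists 0; rewrite mul0r. Qed.

Lemma mod2piD (R : realType) (x y : R) : mod2pi x -> mod2pi y -> mod2pi (x + y).
Proof. by move=> [k ->] [l ->]; exists (k + l); rewrite intrD; ring. Qed.

Lemma mod2piN (R : realType) (x : R) : mod2pi x -> mod2pi (- x).
Proof. by move=> [k ->]; exists (- k); rewrite intrN mulNr. Qed.

Lemma mod2pi_sum (R : realType) (I : Type) (r : seq I) (P : pred I) (F : I -> R) :
  (forall i, mod2pi (F i)) -> mod2pi (\sum_(i <- r | P i) F i).
Proof.
move=> HF; elim/big_ind: _ => //; first exact: mod2pi0.
by move=> x y; exact: mod2piD.
Qed.

Lemma mod2pi_small (R : realType) (x : R) : mod2pi x -> `|x| < 2 * pi -> x = 0.
Proof.
move=> [k ->]; have p0 := pi_gt0 R.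
rewrite normrM [`|2 * pi|]gtr0_norm ?mulr_gt0// -[ltRHS]mul1r ltr_pM2r ?mulr_gt0//.
by rewrite -intr_norm -[1]/(1%:~R) ltr_int => h; have -> : k = 0; [lia | rewrite mul0r].
Qed.

Lemma cosDint2pi (R : realType) (k : int) (x : R) : cos (x + k%:~R * (2 * pi)) = cos x.
Proof.
have H (n : nat) y : cos (y + n%:R * (2 * pi)) = cos y :> R.
  by rewrite -(periodicn (@cosD2pi R) n y); congr cos; rewrite -mulr_natl; ring.
case: k => n; first exact: H.
by rewrite -(H n.+1 (x + _)); congr cos; rewrite NegzE intrN -[_%:~R]/(n.+1%:R); ring.
Qed.

(** A representative [y] in [0, 2 pi) other than 0 would have sin (y / 2) > 0, against cos y = 1 - 2
    sin^2 (y / 2). *)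
Lemma cos_eq1 (R : realType) (x : R) : cos x = 1 -> mod2pi x.
Proof.
have p0 := pi_gt0 R => hx.
pose k := Num.floor (x / (2 * pi)); pose y := x - k%:~R * (2 * pi).
have p20 : 0 < 2 * pi :> R by rewrite mulr_gt0.
have /andP[h1 h2] := floor_itv (x / (2 * pi)).
rewrite -/k ler_pdivlMr // in h1; rewrite -/k ltr_pdivrMr // intrD mulr1z in h2.
have cy : cos y = 1 by rewrite -hx -(cosDint2pi k y) /y subrK.
have hy : 0 <= y < 2 * pi by rewrite /y; apply/andP; split; lra.
exists k; apply/eqP; rewrite -subr_eq0 -/y; apply/eqP.
have [->//|y0] := eqVneq y 0.
have : 0 < sin (y / 2) by apply: sin_gt0_pi; lra.
have : cos (y / 2 *+ 2) = 1 by rewrite -mulr_natl mulrC divfK.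
rewrite cos_mulr2n -[sin _]/(sin (y / 2)); have := cos2Dsin2 (y / 2).
nra.
Qed.

Lemma polar (R : realType) (x y : R) : 0 < x ^+ 2 + y ^+ 2 ->
  exists r t : R, [/\ 0 < r, x = r * cos t & y = r * sin t].
Proof.
move=> h; pose r := Num.sqrt (x ^+ 2 + y ^+ 2).
have r0 : 0 < r by rewrite sqrtr_gt0.
have r2 : r ^+ 2 = x ^+ 2 + y ^+ 2 by rewrite sqr_sqrtr // ltW.
have hx : -1 <= x / r <= 1.
  rewrite -ler_norml normrM normfV (gtr0_norm r0) ler_pdivrMr // mul1r.
  by rewrite -sqrtr_sqr ler_wsqrtr // lerDl sqr_ge0.
have hc : cos (acos (x / r)) = x / r by rewrite acosK // in_itv.
have hs : sin (acos (x / r)) = `|y| / r.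
  have -> : `|y| / r = Num.sqrt ((y / r) ^+ 2).
    by rewrite sqrtr_sqr normf_div (gtr0_norm r0).
  rewrite sin_acos //; congr Num.sqrt.
  by rewrite !expr_div_n r2; field; rewrite -r2 gt_eqF // exprn_gt0.
have [y0|y0] := leP 0 y.
  exists r, (acos (x / r)); rewrite hc hs ger0_norm //.
  by split => //; rewrite mulrC divfK // gt_eqF.
exists r, (- acos (x / r)); rewrite cosN sinN hc hs ltr0_norm //.
by split => //; field; rewrite gt_eqF.
Qed.

(** * Spinors *)

Lemma polar_uniq (R : realType) (r s a b : R) : 0 < r -> 0 < s ->
  r * cos a = s * cos b -> r * sin a = s * sin b -> mod2pi (a - b).
Proof.
move=> r0 s0 hc hs; apply: cos_eq1; rewrite cosB.
have ha := cos2Dsin2 a; have hb := cos2Dsin2 b.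
have e : r ^+ 2 = s ^+ 2.
  rewrite -[LHS]mulr1 -ha -[RHS]mulr1 -hb !mulrDr -!exprMn.
  by rewrite hc hs.
have {e} e : r = s by apply/eqP; rewrite -(@eqrXn2 _ 2) ?ltW//; apply/eqP.
move: hc hs; rewrite e => /(mulfI (lt0r_neq0 s0)) -> /(mulfI (lt0r_neq0 s0)) ->.
by rewrite -!expr2.
Qed.

Definition coord {R : realType} (k : nat) (u : 'rV[R]_3) : R := u 0 (inord k).

Lemma dot3E (R : realType) (u v : 'rV[R]_3) :
  dot3 u v = coord 0 u * coord 0 v + coord 1 u * coord 1 v + coord 2 u * coord 2 v.
Proof.
rewrite /dot3 mxE !big_ord_recl big_ord0 addr0 !mxE addrA /coord.
by congr (_ * _ + _ * _ + _ * _); congr (_ _ _); apply/val_inj; rewrite /= inordK.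
Qed.

Lemma det3E (R : realType) (u v w : 'rV[R]_3) :
  det3 u v w =
    coord 0 u * (coord 1 v * coord 2 w - coord 2 v * coord 1 w)
  - coord 1 u * (coord 0 v * coord 2 w - coord 2 v * coord 0 w)
  + coord 2 u * (coord 0 v * coord 1 w - coord 1 v * coord 0 w).
Proof.
have H (t : 'rV[R]_3) (i : 'I_3) : t 0 i = coord i t :> R by rewrite /coord inord_val.
rewrite /det3 (expand_det_row _ ord0) !big_ord_recl big_ord0 /cofactor.
rewrite !(expand_det_row _ ord0) !big_ord_recl !big_ord0 /cofactor !det_mx11 !mxE /= !H /=.
rewrite /bump /=; ring.
Qed.

Section Phase.
Variable R : realType.
Implicit Types u v w : 'rV[R]_3.

Lemma norm3_gt0 u : 0 < dot3 u u -> 0 < norm3 u.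
Proof. by move=> h; rewrite sqrtr_gt0. Qed.

Lemma sqr_norm3 u : norm3 u ^+ 2 = dot3 u u.
Proof.
rewrite sqr_sqrtr // dot3E -!expr2.
by rewrite !addr_ge0 ?sqr_ge0.
Qed.

(** A spinor (a, b + i c) in C^2 whose outer product with itself is
    k * (|u| + u . sigma), sigma being the Pauli matrices; the south pole
    needs its own chart. *)
Lemma spinor_exists u : 0 < dot3 u u -> exists s : R * R * R * R,
  let: (a, b, c, k) := s in
  [/\ 0 < k, k * norm3 u = (a ^+ 2 + b ^+ 2 + c ^+ 2) / 2, k * coord 0 u = a * b,
     k * coord 1 u = a * c & k * coord 2 u = (a ^+ 2 - b ^+ 2 - c ^+ 2) / 2].
Proof.
move=> /norm3_gt0 n0; have := sqr_norm3 u; rewrite dot3E.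
move: (norm3 u) (coord 0 u) (coord 1 u) (coord 2 u) n0 => n x y z n0 e.
have [h|h] := ltP 0 (n + z).
  by exists (n + z, x, y, n + z); split => //; nra.
have zn : z = - n by nra.
have x0 : x = 0 by nra.
have y0 : y = 0 by nra.
exists (0, 1, 0, (2 * n)^-1); rewrite x0 y0 zn; split; rewrite ?invr_gt0 ?mulr_gt0 //.
- by field; rewrite gt_eqF.
- by ring.
- by ring.
- by field; rewrite gt_eqF.
Qed.

(** The choice need not be continuous in [u]: a change of phase of a spinor cancels in every closed
    product of overlaps. *)
Definition spinor u : R * R * R * R :=
  if pselect (0 < dot3 u u) is left h then projT1 (cid (spinor_exists h)) else (0, 0, 0, 0).

(** Real part of the Hermitian product of the spinors (a, b + i c), conjugate-linear in the first;
    [overlap_im] is the imaginary part. *)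
Definition overlap_re u v : R :=
  let: (a, b, c, _) := spinor u in let: (a', b', c', _) := spinor v in
  a * a' + b * b' + c * c'.

Definition overlap_im u v : R :=
  let: (a, b, c, _) := spinor u in let: (a', b', c', _) := spinor v in
  b * c' - c * b'.

Lemma spinorP u : 0 < dot3 u u -> let: (a, b, c, k) := spinor u in
  [/\ 0 < k, k * norm3 u = (a ^+ 2 + b ^+ 2 + c ^+ 2) / 2, k * coord 0 u = a * b,
     k * coord 1 u = a * c & k * coord 2 u = (a ^+ 2 - b ^+ 2 - c ^+ 2) / 2].
Proof.
by move=> h; rewrite /spinor; case: pselect => // h'; case: cid => -[[[a b] c] k].
Qed.

Definition acute u v := [/\ 0 < dot3 u u, 0 < dot3 v v & 0 < dot3 u v].

(** The squared modulus is a positive multiple of |u| |v| + u . v, which vanishes only for antipodal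
    directions. *)
Lemma overlap_gt0 u v : acute u v -> 0 < overlap_re u v ^+ 2 + overlap_im u v ^+ 2.
Proof.
move=> [hu hv huv]; rewrite /overlap_re /overlap_im.
case: (spinor u) (spinorP hu) => -[[a b] c] k [k0 e1 e2 e3 e4].
case: (spinor v) (spinorP hv) => -[[a' b'] c'] k' [k0' e1' e2' e3' e4'].
have -> : (a * a' + b * b' + c * c') ^+ 2 + (b * c' - c * b') ^+ 2 =
    2 * (k * k') * (norm3 u * norm3 v + dot3 u v).
  (* Every factor is grouped with its own scale [k] or [k'], so that the spinor equations can
     rewrite it. *)
  rewrite dot3E; transitivity (2 * ((k * norm3 u) * (k' * norm3 v) +
   ((k * coord 0 u) * (k' * coord 0 v) + (k * coord 1 u) * (k' * coord 1 v)
    + (k * coord 2 u) * (k' * coord 2 v)))); last by ring.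
  by rewrite e1 e2 e3 e4 e1' e2' e3' e4'; field.
by rewrite !mulr_gt0 // addr_gt0 // mulr_gt0 // norm3_gt0.
Qed.

Definition solid_den u v w := norm3 u * norm3 v * norm3 w
     + dot3 u v * norm3 w + dot3 v w * norm3 u + dot3 w u * norm3 v.

(** The product of the three overlaps is the trace of the product of three
    multiples of projectors, which is a multiple of solid_den + i det3. *)
Lemma overlap_triple u v w : 0 < dot3 u u -> 0 < dot3 v v -> 0 < dot3 w w ->
  exists2 K : R, 0 < K &
  let: (a, b) := (overlap_re u v, overlap_im u v) in
  let: (c, d) := (overlap_re v w, overlap_im v w) in
  let: (e, f) := (overlap_re w u, overlap_im w u) in
  (a * c - b * d) * e - (a * d + b * c) * f = K * solid_den u v w /\
  (a * c - b * d) * f + (a * d + b * c) * e = K * det3 u v w.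
Proof.
move=> hu hv hw; rewrite /overlap_re /overlap_im /solid_den det3E !dot3E.
case: (spinor u) (spinorP hu) => -[[a b] c] k [k0 e1 e2 e3 e4].
case: (spinor v) (spinorP hv) => -[[a' b'] c'] k' [k0' e1' e2' e3' e4'].
case: (spinor w) (spinorP hw) => -[[a'' b''] c''] k'' [k0'' e1'' e2'' e3'' e4''].
move: (norm3 u) (norm3 v) (norm3 w) e1 e1' e1'' => n n' n'' e1 e1' e1''.
move: (coord 0 u) (coord 0 v) (coord 0 w) e2 e2' e2'' => x x' x'' e2 e2' e2''.
move: (coord 1 u) (coord 1 v) (coord 1 w) e3 e3' e3'' => y y' y'' e3 e3' e3''.
move: (coord 2 u) (coord 2 v) (coord 2 w) e4 e4' e4'' => z z' z'' e4 e4' e4''.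
exists (2 * k * k' * k''); first by rewrite !mulr_gt0.
split.
- transitivity (2 * ((k * n) * (k' * n') * (k'' * n'')
    + ((k * x) * (k' * x') + (k * y) * (k' * y') + (k * z) * (k' * z')) * (k'' * n'')
    + ((k' * x') * (k'' * x'') + (k' * y') * (k'' * y'') + (k' * z') * (k'' * z'')) * (k * n)
    + ((k'' * x'') * (k * x) + (k'' * y'') * (k * y) + (k'' * z'') * (k * z)) * (k' * n')));
    last by ring.
  by rewrite e1 e2 e3 e4 e1' e2' e3' e4' e1'' e2'' e3'' e4''; field.
transitivity (2 * (
   (k * x) * ((k' * y') * (k'' * z'') - (k' * z') * (k'' * y''))
 - (k * y) * ((k' * x') * (k'' * z'') - (k' * z') * (k'' * x''))
 + (k * z) * ((k' * x') * (k'' * y'') - (k' * y') * (k'' * x'')))); last by ring.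
by rewrite e2 e3 e4 e2' e3' e4' e2'' e3'' e4''; field.
Qed.

End Phase.

(** * The solid angle cocycle *)

Section SolidAngle.
Variable R : realType.
Implicit Types u v w : 'rV[R]_3.

Lemma dot3C u v : dot3 u v = dot3 v u.
Proof. by rewrite !dot3E; ring. Qed.

Lemma acuteC u v : acute u v -> acute v u.
Proof. by case=> h1 h2 h3; split; rewrite // dot3C. Qed.

(** An arbitrary argument of the overlap; phases are only ever compared modulo 2 pi or
    telescoped. *)
Definition phase u v : R :=
  xget 0 [set t | exists2 r : R, 0 < r & overlap_re u v = r * cos t /\ overlap_im u v = r * sin t]%classic.

Lemma phaseP u v : acute u v ->
  exists2 r : R, 0 < r & overlap_re u v = r * cos (phase u v) /\ overlap_im u v = r * sin (phase u v).
Proof.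
move=> /(overlap_gt0 (R:=R)) /polar [r [t [r0 h1 h2]]].
rewrite /phase; case: xgetP => [x -> //|/(_ t) []]; by exists r.
Qed.

(** Exchanging the vectors conjugates the overlap. *)
Lemma phase_rev u v : acute u v -> mod2pi (phase u v + phase v u).
Proof.
move=> h; have [r r0 [h1 h2]] := phaseP h.
have [s s0 [h3 h4]] := phaseP (acuteC h).
rewrite -[phase v u]opprK; apply: (polar_uniq (r := r) (s := s)) => //.
  rewrite cosN -h1 -h3 /overlap_re; case: (spinor u) => -[[? ?] ?] ?.
  by case: (spinor v) => -[[? ?] ?] ?; ring.
rewrite sinN mulrN -h2 -h4 /overlap_im; case: (spinor u) => -[[? ?] ?] ?.
by case: (spinor v) => -[[? ?] ?] ?; ring.
Qed.

Lemma solid_den_gt0 u v w : acute u v -> acute v w -> acute w u ->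
  0 < solid_den u v w.
Proof.
move=> [u0 v0 uv] [_ w0 vw] [_ _ wu].
by rewrite /solid_den !addr_gt0 // !mulr_gt0 // norm3_gt0.
Qed.

(** The product of the three overlaps is a positive multiple of [solid_den] + i [det3]; as the real
    part is positive, the atan of the quotient is an argument of it. *)
Lemma solid_angle_phase u v w : acute u v -> acute v w -> acute w u ->
  mod2pi (solid_angle u v w / 2 - (phase u v + phase v w + phase w u)).
Proof.
move=> auv avw awu; have d0 := solid_den_gt0 auv avw awu.
have [r r0 [h1 h2]] := phaseP auv.
have [r' r'0 [h1' h2']] := phaseP avw.
have [r'' r''0 [h1'' h2'']] := phaseP awu.
have u0 : 0 < dot3 u u by case: auv.
have v0 : 0 < dot3 v v by case: auv.
have w0 : 0 < dot3 w w by case: avw.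
have [K K0] := overlap_triple u0 v0 w0.
rewrite h1 h2 h1' h2' h1'' h2'' => -[e1 e2].
rewrite /solid_angle -/(solid_den u v w) mulrC mulKf ?pnatr_eq0 //.
set d := solid_den u v w in d0 e1 *; set t := atan _.
have ct : 0 < cos t.
  by apply: cos_gt0_pihalf; rewrite atan_gtNpi2 atan_ltpi2.
have tt : sin t = det3 u v w / d * cos t.
  by rewrite -[det3 u v w / d]atanK -/t /tan mulfVK // gt_eqF.
(* [K * d / cos t] is the modulus of K (d + i [det3]), because tan t = [det3] / d. *)
apply: (polar_uniq (r := K * d / cos t) (s := r * r' * r'')); rewrite ?divr_gt0 ?mulr_gt0 //.
  rewrite mulfVK ?gt_eqF // -e1 !cosD !sinD; ring.
rewrite tt !(sinD, cosD).
transitivity (K * det3 u v w); first by field; rewrite !gt_eqF.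
by rewrite -e2; ring.
Qed.

Lemma solid_angle_bound u v w : `|solid_angle u v w / 2| < pi / 2.
Proof.
rewrite /solid_angle mulrC mulKf ?pnatr_eq0 //.
by rewrite ltr_norml atan_gtNpi2 atan_ltpi2.
Qed.

Lemma solid_angleC u v w : solid_angle v u w = - solid_angle u v w.
Proof.
rewrite /solid_angle -mulrN -atanN -mulNr; congr (_ * atan (_ / _)).
  by rewrite !det3E; ring.
by rewrite !(dot3C u) !(dot3C w); ring.
Qed.

Lemma solid_angle_rot u v w : solid_angle v w u = solid_angle u v w.
Proof.
rewrite /solid_angle; congr (_ * atan (_ / _)); first by rewrite !det3E; ring.
by ring.
Qed.

Lemma solid_angle_swap u v w : solid_angle u w v = - solid_angle u v w.
Proof. by rewrite -[LHS]solid_angle_rot solid_angleC solid_angle_rot. Qed.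

Lemma solid_angleN u v w : solid_angle (- u) (- v) (- w) = - solid_angle u v w.
Proof.
have cN k (t : 'rV[R]_3) : coord k (- t) = - coord k t by rewrite /coord mxE.
rewrite /solid_angle -mulrN -atanN -mulNr /norm3 !dot3E !cN.
congr (_ * atan (_ / _)); first by rewrite !det3E !cN; ring.
by rewrite !mulrNN.
Qed.

(** The alternating sum is a multiple of 4 pi by [solid_angle_phase], and each
    of its four terms is less than pi in absolute value. *)
Lemma solid_angle_cocycle t u v w :
  acute t u -> acute t v -> acute t w -> acute u v -> acute v w -> acute u w ->
  solid_angle u v w = solid_angle t u v + solid_angle t v w - solid_angle t u w.
Proof.
move=> tu tv tw uv vw uw.
have b1 := solid_angle_bound u v w; have b2 := solid_angle_bound t u v.
have b3 := solid_angle_bound t v w; have b4 := solid_angle_bound t u w.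
have m1 := solid_angle_phase uv vw (acuteC uw).
have m2 := solid_angle_phase tu uv (acuteC tv).
have m3 := solid_angle_phase tv vw (acuteC tw).
have m4 := solid_angle_phase tu uw (acuteC tw).
have n1 := phase_rev tv; have n2 := phase_rev uw.
have m : mod2pi (solid_angle u v w / 2 - solid_angle t u v / 2
  - solid_angle t v w / 2 + solid_angle t u w / 2).
  have := mod2piD (mod2piD (mod2piD m1 (mod2piN m2))
   (mod2piD (mod2piN m3) m4)) (mod2piD n2 (mod2piN n1)).
  by congr mod2pi; ring.
have {m} := mod2pi_small m.
have p0 := pi_gt0 R.
move: b1 b2 b3 b4; rewrite !ltr_norml => /andP[? ?] /andP[? ?] /andP[? ?] /andP[? ?].
move=> h; have : solid_angle u v w / 2 - solid_angle t u v / 2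
  - solid_angle t v w / 2 + solid_angle t u w / 2 = 0.
  by apply: h; apply/andP; split; lra.
by lra.
Qed.

End SolidAngle.

(** * Degrees of grids *)

Section Cells.
Variable R : realType.
Local Notation V := 'rV[R]_3.
Implicit Types (a b : V) (A B : set V) (x y : nat -> V).

(** On vectors acute to a fixed [t], the solid angle is the coboundary of [solid_angle t]; this
    makes sums over adjacent triangles telescope. *)
Lemma solid_angle_local (t u v w : V) :
  acute t u -> acute t v -> acute t w -> acute u v -> acute v w -> acute u w ->
  solid_angle u v w = solid_angle t u v + solid_angle t v w + solid_angle t w u.
Proof.
move=> tu tv tw uv vw uw; rewrite (solid_angle_cocycle tu) //.
by rewrite [solid_angle t w u]solid_angle_swap.
Qed.

(** The Gauss map sends A x B into a patch of pairwise acute directions, where the cocycle relation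
    applies to any choice of points. *)
Definition visible A B : Prop := forall a a' b b', A a -> A a' -> B b -> B b' ->
  0 < dot3 (b - a) (b' - a').

Lemma visible_acute A B a a' b b' : visible A B -> A a -> A a' -> B b -> B b' ->
  acute (b - a) (b' - a').
Proof. by move=> h *; split; apply: h. Qed.

Lemma visibleC A B : visible A B -> visible B A.
Proof.
move=> h a a' b b' *; rewrite -[b - a]opprB -[b' - a']opprB.
rewrite /dot3 linearN mulNmx mulmxN opprK; exact: h.
Qed.

Lemma visible_sub A B A' B' : (A' `<=` A)%classic -> (B' `<=` B)%classic ->
  visible A B -> visible A' B'.
Proof. by move=> hA hB h a a' b b' *; apply: h; [exact: hA|exact: hA|exact: hB|exact: hB]. Qed.

(** A summand of [lk_grid]: the square is cut along the diagonal from (a, b) to (a', b'). *)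
Definition cell a a' b b' : R :=
  solid_angle (b - a) (b - a') (b' - a') + solid_angle (b - a) (b' - a') (b' - a).

(** Exchanging the curves applies the antipodal map and reverses the orientation of the square, and
    the two signs cancel. The diagonal is preserved. *)
Lemma cell_swap a a' b b' : cell b b' a a' = cell a a' b b'.
Proof.
rewrite /cell -!(opprB b) -!(opprB b') !solid_angleN.
by rewrite addrC; congr (_ + _); rewrite solid_angle_swap opprK.
Qed.

(** The value is a sum over the boundary of the square: the diagonal is run through once in each
    direction. Opposite sides are grouped together. *)
Lemma cell_local A B a a' b b' (t : V) : visible A B -> A a -> A a' -> B b -> B b' ->
  (forall p q, A p -> B q -> acute t (q - p)) ->
  let F := solid_angle t in
  cell a a' b b' = (F (b - a) (b - a') - F (b' - a) (b' - a'))
                 + (F (b - a') (b' - a') - F (b - a) (b' - a)).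
Proof.
move=> h Aa Aa' Bb Bb' ht F.
have H := visible_acute h.
have FC u v : F v u = - F u v by exact: solid_angle_swap.
have E u v w : acute t u -> acute t v -> acute t w -> acute u v -> acute v w -> acute u w ->
    solid_angle u v w = F u v + F v w + F w u by exact: solid_angle_local.
rewrite /cell E; [|by [apply: ht|apply: H] ..].
rewrite E; [|by [apply: ht|apply: H] ..].
by rewrite (FC (b - a) (b' - a')) (FC (b' - a)) (FC (b - a) (b' - a)); ring.
Qed.

Lemma cell_rev A B a a' b b' : visible A B -> A a -> A a' -> B b -> B b' ->
  cell a' a b b' = - cell a a' b b'.
Proof.
move=> h Aa Aa' Bb Bb'; have H := visible_acute h.
rewrite !(@cell_local A B _ _ _ _ (b - a)) //; try by move=> *; apply: H.
set F := solid_angle _.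
have FC u v : F v u = - F u v by exact: solid_angle_swap.
by rewrite (FC (b - a) (b - a')) (FC (b' - a) (b' - a')); ring.
Qed.

Lemma cell_revr A B a a' b b' : visible A B -> A a -> A a' -> B b -> B b' ->
  cell a a' b' b = - cell a a' b b'.
Proof.
by move=> /visibleC h Aa Aa' Bb Bb'; rewrite -cell_swap (cell_rev h Bb Bb' Aa Aa') cell_swap.
Qed.

Lemma cell_degenerate A B a b b' : visible A B -> A a -> B b -> B b' ->
  cell a a b b' = 0.
Proof. by move=> h Aa Bb Bb'; have := cell_rev h Aa Aa Bb Bb'; lra. Qed.

(** Merging two cells replaces the path a, a', a'' by its chord. The swept triangles appear as a
    function of [b] minus the same function of [b'], so they will telescope along the second
    curve. *)
Lemma cell_add A B a a' a'' b b' : visible A B -> A a -> A a' -> A a'' -> B b -> B b' ->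
  cell a a' b b' + cell a' a'' b b' = cell a a'' b b'
   + (solid_angle (b - a) (b - a') (b - a'') - solid_angle (b' - a) (b' - a') (b' - a'')).
Proof.
move=> h Aa Aa' Aa'' Bb Bb'; have H := visible_acute h.
rewrite !(@cell_local A B _ _ _ _ (b - a)) //; try by move=> *; apply: H.
rewrite (@solid_angle_local (b - a) (b' - a)); [|by apply: H ..].
set F := solid_angle (b - a).
have FC u v : F v u = - F u v by exact: solid_angle_swap.
have F0 u : F (b - a) u = 0.
  by rewrite /F; have := solid_angleC (b - a) (b - a) u; lra.
rewrite (FC (b' - a) (b' - a'')) !F0.
ring.
Qed.

Lemma cell_chunk A B (z : nat -> V) b b' K : visible A B -> B b -> B b' ->
  (forall k, (k <= K)%N -> A (z k)) ->
  \sum_(k < K) cell (z k) (z k.+1) b b' = cell (z 0%N) (z K) b b'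
   + (\sum_(k < K) solid_angle (b - z 0%N) (b - z k) (b - z k.+1)
      - \sum_(k < K) solid_angle (b' - z 0%N) (b' - z k) (b' - z k.+1)).
Proof.
move=> h Bb Bb'; elim: K => [|K IH] hz.
  by rewrite !big_ord0 (cell_degenerate h (hz 0%N isT) Bb Bb'); ring.
rewrite !big_ord_recr /= IH => [|k hk]; last by apply: hz; exact: leqW.
have := cell_add h (hz 0%N isT) (hz K (leqnSn K)) (hz K.+1 (leqnn _)) Bb Bb'.
lra.
Qed.

End Cells.

(** * Grid sums: refinement and integrality *)

Section Grid.
Variable R : realType.
Local Notation V := 'rV[R]_3.
Implicit Types (x y : nat -> V).

Definition grid x y M N : R :=
  \sum_(i < M) \sum_(j < N) cell (x i) (x i.+1) (y j) (y j.+1).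

Lemma grid_swap x y M N : grid y x N M = grid x y M N.
Proof.
rewrite /grid exchange_big; apply: eq_bigr => i _; apply: eq_bigr => j _.
exact: cell_swap.
Qed.

Definition chunk x K i : set V := [set x k | k in [set k | (i * K <= k <= i.+1 * K)%N]]%classic.

Lemma chunkP x K i k : (i * K <= k <= i.+1 * K)%N -> chunk x K i (x k).
Proof. by exists k. Qed.

Lemma big_ord_blocks (k N : nat) (F : nat -> R) :
  \sum_(i < k * N) F i = \sum_(i < k) \sum_(r < N) F (i * N + r)%N.
Proof.
rewrite -(big_mkord xpredT F) big_nat_mul big_mkord; apply: eq_bigr => i _.
rewrite -{1}[(i * N)%N]add0n big_addn mulSn addnK big_mkord.
by apply: eq_bigr => r _; rewrite addnC.
Qed.

(** The defects from [cell_chunk] are differences of [T i] at consecutive points of [y], and cancel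
    around the closed curve [y]. *)
Lemma grid_refine x y M K N : y N = y 0%N ->
  (forall i j, (i < M)%N -> (j < N)%N -> visible (chunk x K i) (chunk y 1 j)) ->
  grid x y (M * K) N = grid (fun i => x (i * K)%N) y M N.
Proof.
move=> yN h; pose T i b :=
  \sum_(k < K) solid_angle (b - x (i * K)%N) (b - x (i * K + k)%N) (b - x (i * K + k.+1)%N).
have tele i : \sum_(j < N) (T i (y j) - T i (y j.+1)) = 0.
  rewrite -(big_mkord xpredT (fun j => T i (y j) - T i (y j.+1))).
  by rewrite (@telescope_sumr_eq _ _ _ (fun j => - T i (y j))) // => [|j _]; [rewrite yN|]; ring.
rewrite /grid exchange_big /= [RHS]exchange_big /=.
transitivity (\sum_(j < N) \sum_(i < M) (cell (x (i * K)%N) (x (i.+1 * K)%N) (y j) (y j.+1)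
   + (T i (y j) - T i (y j.+1)))).
  apply: eq_bigr => j _.
  rewrite (big_ord_blocks _ _ (fun i => cell (x i) (x i.+1) (y j) (y j.+1))).
  apply: eq_bigr => i _.
  have hv := h i j (ltn_ord i) (ltn_ord j).
  have := @cell_chunk R _ _ (fun k => x (i * K + k)%N) (y j) (y j.+1) K hv.
  rewrite addn0 [(i * K + K)%N]addnC -mulSn => E; apply: (etrans _ (E _ _ _)).
  - by apply: eq_bigr => k _; rewrite addnS.
  - by apply: chunkP; rewrite !muln1 leqnn leqnSn.
  - by apply: chunkP; rewrite !muln1 leqnn leqnSn.
  - by move=> k hk; apply: chunkP; rewrite leq_addr mulSn addnC leq_add2r.
transitivity (\sum_(j < N) \sum_(i < M) cell (x (i * K)%N) (x (i.+1 * K)%N) (y j) (y j.+1)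
  + \sum_(i < M) \sum_(j < N) (T i (y j) - T i (y j.+1))).
  rewrite [X in _ + X]exchange_big -big_split; apply: eq_bigr => j _.
  by rewrite big_split.
by rewrite [X in _ + X]big1 ?addr0.
Qed.

Lemma grid_blocks x y (x' y' : nat -> nat -> V) k l M N :
  (forall i r, (i < k)%N -> (r <= M)%N -> x (i * M + r)%N = x' i r) ->
  (forall j r, (j < l)%N -> (r <= N)%N -> y (j * N + r)%N = y' j r) ->
  grid x y (k * M) (l * N) = \sum_(i < k) \sum_(j < l) grid (x' i) (y' j) M N.
Proof.
move=> hx hy; rewrite /grid.
rewrite (big_ord_blocks _ _ (fun i => \sum_(j < l * N) cell (x i) (x i.+1) (y j) (y j.+1))).
apply: eq_bigr => i _.
rewrite [RHS]exchange_big /=; apply: eq_bigr => r _.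
rewrite (big_ord_blocks _ _ (fun j => cell _ _ (y j) (y j.+1))).
apply: eq_bigr => j _; apply: eq_bigr => r' _.
by rewrite -!addnS !hx ?hy // ltnW.
Qed.

(** Modulo 2 pi, half the sum is a sum of phases over sides of cells. Diagonals cancel with their
    reverses, and the sides [H] and [W] telescope because both curves close up. Hence the sum itself
    lies in 4 pi Z. *)
Lemma grid_integral x y M N : x M = x 0%N -> y N = y 0%N ->
  (forall i j, (i < M)%N -> (j < N)%N -> visible (chunk x 1 i) (chunk y 1 j)) ->
  exists k : int, (4 * pi)^-1 * grid x y M N = k%:~R.
Proof.
move=> xM yN h.
pose H i j := phase (y j - x i) (y j - x i.+1).
pose W i j := phase (y j - x i) (y j.+1 - x i).
have e : \sum_(i < M) \sum_(j < N) (H i j - H i j.+1 + (W i.+1 j - W i j)) = 0.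
  transitivity (\sum_(i < M) \sum_(j < N) (H i j - H i j.+1)
     + \sum_(j < N) \sum_(i < M) (W i.+1 j - W i j)).
    rewrite [X in _ + X]exchange_big -big_split; apply: eq_bigr => i _.
    by rewrite -big_split.
  rewrite !big1 ?addr0 // => k _.
    rewrite -(big_mkord xpredT (fun i => W i.+1 k - W i k)) telescope_sumr //.
    by rewrite /W xM subrr.
  rewrite -(big_mkord xpredT (fun j => H k j - H k j.+1)).
  rewrite (@telescope_sumr_eq _ _ _ (fun j => - H k j)) // => [|j _]; last by ring.
  by rewrite /H yN; ring.
have [k] : mod2pi (grid x y M N / 2 - 0).
  rewrite -e /grid mulr_suml -sumrB; apply: mod2pi_sum => i.
  rewrite mulr_suml -sumrB; apply: mod2pi_sum => j.
  have hv := visible_acute (h i j (ltn_ord i) (ltn_ord j)).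
  have c k z : chunk z 1 k (z k) by apply: chunkP; rewrite !muln1 leqnn leqnSn.
  have c' k z : chunk z 1 k (z k.+1) by apply: chunkP; rewrite !muln1 leqnn leqnSn.
  set a := x i; set a' := x i.+1; set b := y j; set b' := y j.+1.
  have m1 : mod2pi (solid_angle (b - a) (b - a') (b' - a') / 2 -
     (phase (b - a) (b - a') + phase (b - a') (b' - a') + phase (b' - a') (b - a))).
    by apply: solid_angle_phase; apply: hv.
  have m2 : mod2pi (solid_angle (b - a) (b' - a') (b' - a) / 2 -
     (phase (b - a) (b' - a') + phase (b' - a') (b' - a) + phase (b' - a) (b - a))).
    by apply: solid_angle_phase; apply: hv.
  have m3 : mod2pi (phase (b' - a') (b - a) + phase (b - a) (b' - a')).
    by apply: phase_rev; apply: hv.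
  have m4 : mod2pi (phase (b' - a') (b' - a) + phase (b' - a) (b' - a')).
    by apply: phase_rev; apply: hv.
  have m5 : mod2pi (phase (b' - a) (b - a) + phase (b - a) (b' - a)).
    by apply: phase_rev; apply: hv.
  have := mod2piD (mod2piD m1 m2) (mod2piD m3 (mod2piD m4 m5)).
  by congr mod2pi; rewrite /H /W /cell; ring.
rewrite subr0 => hk; exists k.
have -> : grid x y M N = k%:~R * (2 * pi) * 2 by rewrite -hk divfK.
have p0 : pi != 0 :> R by rewrite gt_eqF // pi_gt0.
by move: (pi : R) p0 => p p0; field.
Qed.

End Grid.

(** * The linking number of two curves *)

Section Curves.
Import numFieldNormedType.Exports.
Variable R : realType.
Local Notation V := 'rV[R]_3.
Implicit Types (c d : R -> V).

Definition sample c M (i : nat) : V := c (i%:R / M%:R).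

(** Separate sample sizes allow one curve to be refined while the other stays fixed. *)
Definition curve_grid c d M N : R := grid (sample c M) (sample d N) M N.

Lemma lk_gridE c d N : lk_grid c d N = (4 * pi)^-1 * curve_grid c d N N.
Proof. by []. Qed.

Lemma curve_grid_swap c d M N : curve_grid d c N M = curve_grid c d M N.
Proof. exact: grid_swap. Qed.

Lemma lkC c d : lk d c = lk c d.
Proof.
rewrite /lk; suff -> : lk_grid d c = lk_grid c d by [].
by apply/funext => N; rewrite !lk_gridE curve_grid_swap.
Qed.

Definition fine c d M N := forall i j, (i < M)%N -> (j < N)%N ->
  visible (c @` `[i%:R / M%:R, i.+1%:R / M%:R])%classic
          (d @` `[j%:R / N%:R, j.+1%:R / N%:R])%classic.

Lemma fineC c d M N : fine c d M N -> fine d c N M.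
Proof. by move=> h i j hi hj; apply/visibleC/h. Qed.

Lemma ler_frac (a b k l : nat) : (0 < b)%N -> (0 < l)%N ->
  (a%:R / b%:R <= k%:R / l%:R :> R) = (a * l <= k * b)%N.
Proof.
move=> b0 l0; rewrite ler_pdivrMr ?ltr0n // mulrAC ler_pdivlMr ?ltr0n //.
by rewrite -!natrM ler_nat.
Qed.

Lemma sample_chunk c M K i : (0 < K)%N -> (0 < M)%N ->
  (chunk (sample c (M * K)) K i `<=` c @` `[i%:R / M%:R, i.+1%:R / M%:R])%classic.
Proof.
move=> K0 M0 _ [k /andP[h1 h2] <-]; exists (k%:R / (M * K)%:R) => //=.
rewrite in_itv /= !ler_frac ?muln_gt0 ?M0 ?K0 //.
by apply/andP; split; rewrite [(M * K)%N]mulnC mulnA leq_mul2r ?h1 ?h2 orbT.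
Qed.

Lemma curve_grid_refinel c d M K N : (0 < M)%N -> (0 < K)%N -> (0 < N)%N -> d 1 = d 0 ->
  fine c d M N -> curve_grid c d (M * K) N = curve_grid c d M N.
Proof.
move=> M0 K0 N0 d10 hf.
have e i : sample c (M * K) (i * K) = sample c M i.
  by rewrite /sample !natrM -mulf_div divff ?mulr1 // pnatr_eq0 -lt0n.
rewrite /curve_grid grid_refine.
- by rewrite /grid; apply: eq_bigr => i _; apply: eq_bigr => j _; rewrite !e.
- by rewrite /sample divff ?mul0r // pnatr_eq0 -lt0n.
move=> i j hi hj; apply: visible_sub (hf i j hi hj); first exact: sample_chunk.
by rewrite -[X in sample d X](muln1 N); exact: sample_chunk.
Qed.

Definition eventually_fine c d M0 N0 := forall M N, (M0 <= M)%N -> (N0 <= N)%N -> fine c d M N.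

(** Both grids are compared with their common refinement into [M * M'] samples. *)
Lemma curve_grid_constl c d M0 N0 M M' N : (0 < M0)%N -> (0 < N0)%N -> d 1 = d 0 ->
  eventually_fine c d M0 N0 -> (M0 <= M)%N -> (M0 <= M')%N -> (N0 <= N)%N ->
  curve_grid c d M N = curve_grid c d M' N.
Proof.
move=> M00 N00 d10 hf hM hM' hN.
have M_0 := leq_trans M00 hM; have M'_0 := leq_trans M00 hM'; have N_0 := leq_trans N00 hN.
rewrite -(@curve_grid_refinel _ _ M M') //; last exact: hf.
by rewrite mulnC curve_grid_refinel //; exact: hf.
Qed.

Lemma curve_grid_const c d M0 N0 M N M' N' : (0 < M0)%N -> (0 < N0)%N ->
  c 1 = c 0 -> d 1 = d 0 -> eventually_fine c d M0 N0 ->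
  (M0 <= M)%N -> (M0 <= M')%N -> (N0 <= N)%N -> (N0 <= N')%N ->
  curve_grid c d M N = curve_grid c d M' N'.
Proof.
move=> M00 N00 c10 d10 hf hM hM' hN hN'.
rewrite (@curve_grid_constl c d M0 N0 M M' N) // -!(curve_grid_swap c d).
apply: (@curve_grid_constl d c N0 M0) => // P Q hP hQ; apply: fineC; exact: hf.
Qed.

(** The limit runs over square grids, whereas cycles call for grids whose two sizes are multiples of
    their own lengths; all fine enough grids agree. *)
Lemma lk_curve_grid c d M0 N0 M N : (0 < M0)%N -> (0 < N0)%N ->
  c 1 = c 0 -> d 1 = d 0 -> eventually_fine c d M0 N0 -> (M0 <= M)%N -> (N0 <= N)%N ->
  lk c d = (4 * pi)^-1 * curve_grid c d M N.
Proof.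
move=> M00 N00 c10 d10 hf hM hN; rewrite /lk; apply: cvg_lim => //.
apply: cvg_near_cst.
near=> K; rewrite lk_gridE; congr (_ * _).
have hK : (maxn M0 N0 <= K)%N by near: K; exact: nbhs_infty_ge.
by move: hK; rewrite geq_max => /andP[? ?]; apply: (@curve_grid_const _ _ M0 N0).
Unshelve. all: by end_near.
Qed.

Lemma lk_integral c d M0 N0 : (0 < M0)%N -> (0 < N0)%N ->
  c 1 = c 0 -> d 1 = d 0 -> eventually_fine c d M0 N0 -> exists k : int, lk c d = k%:~R.
Proof.
move=> M00 N00 c10 d10 hf; rewrite (@lk_curve_grid _ _ M0 N0 M0 N0) //.
apply: grid_integral.
- by rewrite /sample divff ?mul0r // pnatr_eq0 -lt0n.
- by rewrite /sample divff ?mul0r // pnatr_eq0 -lt0n.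
move=> i j hi hj; apply: visible_sub (hf M0 N0 (leqnn _) (leqnn _) i j hi hj).
  by rewrite -[X in sample c X](muln1 M0); exact: sample_chunk.
by rewrite -[X in sample d X](muln1 N0); exact: sample_chunk.
Qed.

End Curves.

(** * Curves in embedded graphs *)

Section Edges.
Import numFieldNormedType.Exports.
Local Open Scope classical_set_scope.
Variable R : realType.
Local Notation V := 'rV[R]_3.

Lemma coord_le_norm (u : V) k : `|coord k u| <= `|u|.
Proof.
rewrite [leRHS]mx_normrE; exact: (le_bigmax_cond _ (fun ij => `|u ij.1 ij.2|) (j := (0, inord k))).
Qed.

(** The norm of a row vector is the maximum norm, so its square is the square of some coordinate. *)
Lemma norm_le_dot3 (u : V) : `|u| ^+ 2 <= dot3 u u.
Proof.
have [->|u0] := eqVneq u 0.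
  by rewrite normr0 expr0n /= /dot3 mul0mx mxE.
have [|[i j] /= e] := @mx_norm_neq0 _ _ _ u; first by rewrite -[mx_norm u]/(`|u|) normr_eq0.
rewrite [X in X ^+ 2]e real_normK ?num_real // dot3E.
have -> : u i j = coord j u by rewrite /coord inord_val ord1.
have s k : 0 <= coord k u * coord k u by rewrite -expr2 sqr_ge0.
by case: j {e} => -[|[|[|//]]] /= _; rewrite expr2; have := s 0%N; have := s 1%N; have := s 2%N; lra.
Qed.

(** The 3 counts coordinates: it bounds the squared Euclidean norm of u - v by 3 times the squared
    maximum norm, hence by u . u; then 2 u . v = u . u + v . v - (u - v) . (u - v) is positive. *)
Lemma dot3_gt0_close (u v : V) : 3 * `|u - v| ^+ 2 < `|u| ^+ 2 -> 0 < dot3 u v.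
Proof.
move=> h; have h1 := norm_le_dot3 u.
have cB k : coord k (u - v) = coord k u - coord k v by rewrite /coord !mxE.
have e k : (coord k u - coord k v) ^+ 2 <= `|u - v| ^+ 2.
  by rewrite -cB -[leLHS]real_normK ?num_real // lerXn2r ?nnegrE // coord_le_norm.
move: h1; rewrite !dot3E; have := e 0%N; have := e 1%N; have := e 2%N.
have s k : 0 <= coord k v ^+ 2 by rewrite sqr_ge0.
move: (s 0%N) (s 1%N) (s 2%N); lra.
Qed.

Lemma edge_point_continuous m (u v : 'I_m) : continuous (@edge_point R m u v).
Proof.
move=> t; apply: cvgD; apply: cvgZ; [|exact: cvg_cst|exact: cvg_id|exact: cvg_cst].
by apply: cvgB; [exact: cvg_cst|exact: cvg_id].
Qed.

Lemma edge_curve_continuous m (f : 'rV[R]_m -> V) (u v : 'I_m) :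
  {within complete_graph R m, continuous f} -> forall t : R, 0 <= t <= 1 -> forall e : R, 0 < e ->
  \forall s \near t, 0 <= s <= 1 -> `|f (edge_point u v t) - f (edge_point u v s)| < e.
Proof.
move=> /subspace_continuousP cf t t01 e e0.
have inG s : 0 <= s <= 1 -> complete_graph R m (edge_point u v s) by exists u, v, s.
have /cvgrPdist_lt /(_ e e0) h := cf _ (inG t t01).
have H : \forall s \near t, complete_graph R m (edge_point u v s) ->
    `|f (edge_point u v t) - f (edge_point u v s)| < e.
  exact: (@edge_point_continuous m u v t _ h).
by near=> s => s01; move: (inG s s01); near: s.
Unshelve. all: by end_near.
Qed.

Lemma half_split (d a b e : R) : d <= a + b -> a < d / 2 -> e < d / 2 -> e < b.
Proof. lra. Qed.

(** Compactness of [0, 1] is used in near-covering form, with [N] at infinity as the parameter;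
    [filter_forall] then finds one [N] for the finitely many pairs of vertices. *)
Lemma edges_uniformly_continuous m (f : 'rV[R]_m -> V) :
  {within complete_graph R m, continuous f} -> forall e : R, 0 < e ->
  exists2 N : nat, (0 < N)%N & forall u v (s t : R), 0 <= s <= 1 -> 0 <= t <= 1 ->
    `|s - t| <= N%:R^-1 -> `|f (edge_point u v s) - f (edge_point u v t)| < e.
Proof.
move=> cf e e0.
have [N _ hN] : \forall N \near \oo, forall uv : 'I_m * 'I_m, `[0, 1] `<=`
   [set s : R | forall t, 0 <= t <= 1 -> `|s - t| <= N.+1%:R^-1 ->
    `|f (edge_point uv.1 uv.2 s) - f (edge_point uv.1 uv.2 t)| < e].
  apply: filter_forall => -[u v] /=.
  have /compact_near_coveringP/near_covering_withinP := @segment_compact R 0 1.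
  apply => t0; rewrite /= in_itv /= => t01.
  have e20 : 0 < e / 2 by rewrite divr_gt0.
  have /nbhs_ballP[d /= d0 hd] := edge_curve_continuous u v cf t01 e20.
  have d20 : 0 < d / 2 by rewrite divr_gt0.
  exists (ball t0 (d / 2), [set N | N.+1%:R^-1 < d / 2]) => /=.
    by split; [exact: nbhsx_ballx | exact: near_infty_natSinv_lt (PosNum d20)].
  move=> [s N] /= [hs hN]; rewrite in_itv /= => s01 t t_01 hst.
  have st0 : `|t0 - s| < d / 2 by move: hs; rewrite /ball /=.
  have h1 := hd s _ s01; have h2 := hd t _ t_01.
  have {}h1 : `|f (edge_point u v t0) - f (edge_point u v s)| < e / 2.
    by apply: h1; rewrite /ball /=; lra.
  have {}h2 : `|f (edge_point u v t0) - f (edge_point u v t)| < e / 2.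
    apply: h2; rewrite /ball /=; apply: le_lt_trans (ler_distD s _ _) _. by rewrite [ltRHS]splitr ltrD // (le_lt_trans hst).
  by apply: le_lt_trans (ler_distD (f (edge_point u v t0)) _ _) _; rewrite distrC; lra.
exists N.+1 => // u v s t s01 t01 hst.
by apply: (hN N _ (u, v)) => //=.
Qed.

(** Two nested compactness arguments: for a fixed point [s0] of the first edge the second edge keeps
    a distance [d], and half of [d] survives when [s] moves near [s0]. *)
Lemma edges_separated m n (f : 'rV[R]_m -> V) (g : 'rV[R]_n -> V) :
  disjointly_embedded f g -> exists2 e : R, 0 < e &
  forall u v x y (s t : R), 0 <= s <= 1 -> 0 <= t <= 1 ->
    e <= `|g (edge_point x y t) - f (edge_point u v s)|.
Proof.
move=> [[cf _] [cg _] fg0].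
have [N _ hN] : \forall N \near \oo, forall uvxy : ('I_m * 'I_m) * ('I_n * 'I_n), `[0, 1] `<=`
   [set s : R | forall t, 0 <= t <= 1 -> N.+1%:R^-1 <=
    `|g (edge_point uvxy.2.1 uvxy.2.2 t) - f (edge_point uvxy.1.1 uvxy.1.2 s)|].
  apply: filter_forall => -[[u v] [x y]] /=.
  have /compact_near_coveringP/near_covering_withinP := @segment_compact R 0 1.
  apply => s0; rewrite /= in_itv /= => s01.
  have [d d0 hd] : exists2 d : R, 0 < d & forall t, 0 <= t <= 1 ->
      d <= `|g (edge_point x y t) - f (edge_point u v s0)|.
    have : \forall N \near \oo, `[0, 1] `<=` [set t : R | N.+1%:R^-1 <=
       `|g (edge_point x y t) - f (edge_point u v s0)|].
      have /compact_near_coveringP/near_covering_withinP := @segment_compact R 0 1.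
      apply => t0; rewrite /= in_itv /= => t01.
      have d0 : 0 < `|g (edge_point x y t0) - f (edge_point u v s0)|.
        rewrite normr_gt0 subr_eq0; apply/eqP => e.
        have : (f @` complete_graph R m `&` g @` complete_graph R n) (f (edge_point u v s0)).
          split; first by exists (edge_point u v s0) => //; exists u, v, s0.
          by rewrite -e; exists (edge_point x y t0) => //; exists x, y, t0.
        by rewrite fg0.
      set d := `|_ - _| in d0.
      have d20 : 0 < d / 2 by rewrite divr_gt0.
      have hn := edge_curve_continuous x y cg t01 d20.
      exists ([set t | 0 <= t <= 1 -> `|g (edge_point x y t0) - g (edge_point x y t)| < d / 2],
        [set N | N.+1%:R^-1 < d / 2]) => /=.
        by split; [exact: hn | exact: near_infty_natSinv_lt (PosNum d20)].
      move=> [t N] /= [ht hN]; rewrite in_itv /= => /ht {}ht.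
      have := ler_distD (g (edge_point x y t)) (g (edge_point x y t0)) (f (edge_point u v s0)).
      by move=> h; exact: ltW (half_split h ht hN).
    move=> [N _ hN]; exists N.+1%:R^-1; first by rewrite invr_gt0 ltr0n.
    by move=> t t01; apply: (hN N (leqnn N)); rewrite /= in_itv.
  have d20 : 0 < d / 2 by rewrite divr_gt0.
  have hn := edge_curve_continuous u v cf s01 d20.
  exists ([set s | 0 <= s <= 1 -> `|f (edge_point u v s0) - f (edge_point u v s)| < d / 2],
    [set N | N.+1%:R^-1 < d / 2]) => /=.
    by split; [exact: hn | exact: near_infty_natSinv_lt (PosNum d20)].
  move=> [s N] /= [hs hN]; rewrite in_itv /= => /hs {}hs t t01.
  have := ler_distD (f (edge_point u v s)) (g (edge_point x y t)) (f (edge_point u v s0)).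
  rewrite [`|f (edge_point u v s) - f (edge_point u v s0)|]distrC.
  move=> h; rewrite [leRHS]addrC in h; apply/ltW.
  exact: half_split (le_trans (hd t t01) h) hs hN.
exists N.+1%:R^-1; first by rewrite invr_gt0 ltr0n.
move=> u v x y s t s01 t01.
by apply: (hN N _ ((u, v), (x, y))) => //=.
Qed.

End Edges.

(** * Curves of cycles: closedness and uniform estimates *)

Section Cycles.
Import numFieldNormedType.Exports.
Local Open Scope classical_set_scope.
Variable R : realType.
Local Notation V := 'rV[R]_3.

(** The constants fit [dot3_gt0_close]: the two difference vectors are at most 4 e apart and at
    least 8 e long, and 3 * 16 < 64. *)
Lemma visible_close (A B : set V) (e : R) : 0 < e ->
  (forall a a', A a -> A a' -> `|a - a'| < 2 * e) ->
  (forall b b', B b -> B b' -> `|b - b'| < 2 * e) ->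
  (forall a b, A a -> B b -> 8 * e <= `|b - a|) -> visible A B.
Proof.
move=> e0 hA hB hAB a a' b b' Aa Aa' Bb Bb'; apply: dot3_gt0_close.
have h : `|(b - a) - (b' - a')| <= 4 * e.
  have -> : (b - a) - (b' - a') = (b - b') + (a' - a) by apply/matrixP => i j; rewrite !mxE; ring.
  apply: le_trans (ler_normD _ _) _; have := hA _ _ Aa' Aa; have := hB _ _ Bb Bb'.
  by move: `|_| `|_| => x y; lra.
have := hAB _ _ Aa Bb; have := normr_ge0 ((b - a) - (b' - a')); move: h.
move: `|_| `|b - a| => x y; nra.
Qed.

Lemma edge_point0 m (u v : 'I_m) : edge_point u v 0 = delta_mx 0 u :> 'rV[R]_m.
Proof. by rewrite /edge_point subr0 scale1r scale0r addr0. Qed.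

Lemma edge_point1 m (u v : 'I_m) : edge_point u v 1 = delta_mx 0 v :> 'rV[R]_m.
Proof. by rewrite /edge_point subrr scale1r scale0r add0r. Qed.

Lemma edge_point_rev m (u v : 'I_m) t : edge_point v u t = edge_point u v (1 - t) :> 'rV[R]_m.
Proof. by rewrite /edge_point opprB addrCA subrr addr0 addrC. Qed.

Section Curve.
Import numFieldNormedType.Exports.
Local Open Scope classical_set_scope.
Variables (m : nat) (f : 'rV[R]_m -> V) (s : seq 'I_m) (p0 : 'I_m).
Hypothesis s0 : (0 < size s)%N.
Local Notation k := (size s).

Lemma cycle_curve_edge i (t : R) : (i < k)%N -> i%:R <= k%:R * t <= i.+1%:R ->
  cycle_curve f s t = f (edge_point (nth p0 s i) (nth p0 s (i.+1 %% k)) (k%:R * t - i%:R)).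
Proof.
move=> ik; rewrite /cycle_curve; set x := k%:R * t => /andP[h1 h2].
have nE j : [seq delta_mx 0 p | p <- s]`_(j %% k) = delta_mx 0 (nth p0 s (j %% k)) :> 'rV[R]_m.
  by rewrite (nth_map p0) // ltn_mod.
rewrite !nE; move: h2; rewrite le_eqVlt => /orP[/eqP xE|h2]; last first.
  by rewrite (@truncn_def _ x i) ?h1 // [(i %% k)%N]modn_small.
(* At the right end of the edge the truncation has already passed to the next edge, which starts at
   the same vertex. *)
have -> : Num.trunc x = i.+1 by apply: truncn_def; rewrite xE lexx ltr_nat ltnS /=.
have -> : x - i%:R = 1 by rewrite xE -natr1 addrAC subrr add0r.
by rewrite edge_point1 xE subrr subr0 scale1r scale0r addr0.
Qed.

Lemma cycle_curve_closed : cycle_curve f s 1 = cycle_curve f s 0.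
Proof.
rewrite (@cycle_curve_edge k.-1) ?prednK //; last first.
  by rewrite mulr1 lexx ler_nat leq_pred.
rewrite (@cycle_curve_edge 0) ?mulr0 ?lexx ?ler0n // subr0 edge_point0 modnn mulr1.
by rewrite -{2}(prednK s0) -natr1 addrAC subrr add0r edge_point1.
Qed.

Lemma unit_interval_chunk (t : R) : 0 <= t <= 1 ->
  exists2 i, (i < k)%N & i%:R <= k%:R * t <= i.+1%:R.
Proof.
move=> /andP[t0 t1]; have kp : 0 < k%:R :> R by rewrite ltr0n.
have [t1'|t1'] := ltP t 1.
  have x0 : 0 <= k%:R * t by rewrite mulr_ge0 // ltW.
  have /andP[h1 h2] := truncn_itv x0.
  exists (Num.trunc (k%:R * t)); last by rewrite h1 ltW.
  by rewrite -(ltr_nat R); apply: le_lt_trans h1 _; rewrite -[ltRHS]mulr1 ltr_pM2l.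
(* Here the truncation would be [k], one past the last edge; the closed interval of the last edge
   contains the point. *)
have -> : t = 1 by apply/le_anti; rewrite t1.
exists k.-1; first by rewrite prednK.
by rewrite prednK // mulr1 lexx ler_nat leq_pred.
Qed.

Lemma cycle_curve_on_edge (t : R) : 0 <= t <= 1 -> exists u v (r : R),
  0 <= r <= 1 /\ cycle_curve f s t = f (edge_point u v r).
Proof.
move=> /unit_interval_chunk [i ik hi].
exists (nth p0 s i), (nth p0 s (i.+1 %% k)), (k%:R * t - i%:R).
split; last exact: cycle_curve_edge.
by move: hi; rewrite -natr1 => /andP[h1 h2]; apply/andP; split; lra.
Qed.

Variables (N : nat) (e : R).
Hypothesis N0 : (0 < N)%N.
Hypothesis hN : forall u v (p q : R), 0 <= p <= 1 -> 0 <= q <= 1 ->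
    `|p - q| <= N%:R^-1 -> `|f (edge_point u v p) - f (edge_point u v q)| < e.

Lemma cycle_curve_close1 i (t t' : R) : (i < k)%N -> i%:R <= k%:R * t <= i.+1%:R ->
  i%:R <= k%:R * t' <= i.+1%:R -> `|t - t'| <= (k * N)%:R^-1 ->
  `|cycle_curve f s t - cycle_curve f s t'| < e.
Proof.
move=> ik ht ht' h; rewrite !(@cycle_curve_edge i) //; apply: hN.
- by move: ht; rewrite -natr1 => /andP[h1 h2]; apply/andP; split; lra.
- by move: ht'; rewrite -natr1 => /andP[h1 h2]; apply/andP; split; lra.
have kp : 0 < k%:R :> R by rewrite ltr0n.
have -> : k%:R * t - i%:R - (k%:R * t' - i%:R) = k%:R * (t - t') by ring.
by rewrite normrM gtr0_norm // mulrC -ler_pdivlMr // -invfM -natrM mulnC.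
Qed.

(** Parameters this close lie on one edge or on two consecutive ones; in the latter case the path is
    cut at the common vertex, at time [t1], whence the factor 2. *)
Lemma cycle_curve_close (t t' : R) : 0 <= t <= 1 -> 0 <= t' <= 1 ->
  `|t - t'| <= (k * N)%:R^-1 -> `|cycle_curve f s t - cycle_curve f s t'| < 2 * e.
Proof.
wlog tt : t t' / t <= t'.
  move=> H ht ht' h; have [|/ltW] := leP t t'; first by move=> ?; exact: H.
  by move=> ?; rewrite distrC; apply: H => //; rewrite distrC.
move=> t01 t'01 h; have [i ik hi] := unit_interval_chunk t01.
have e0 : 0 < e.
  by apply: le_lt_trans (normr_ge0 _) (@hN p0 p0 0 0 _ _ _); rewrite ?subrr ?normr0 ?invr_ge0 ?ler0n ?lexx ?ler01.
have kp : 0 < k%:R :> R by rewrite ltr0n.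
have Np : 1 <= N%:R :> R by rewrite ler1n.
have [h2|h2] := leP (k%:R * t') i.+1%:R.
  apply: lt_trans (@cycle_curve_close1 i t t' ik hi _ h) _; last by lra.
  rewrite h2 andbT; apply: le_trans (_ : k%:R * t <= _); first by case/andP: hi.
  by rewrite ler_pM2l.
have ik' : (i.+1 < k)%N.
  by rewrite -(ltr_nat R); apply: lt_le_trans h2 _; rewrite ger_pMr //; case/andP: t'01.
move: h; rewrite distrC ger0_norm ?subr_ge0 // => h.
pose t1 : R := i.+1%:R / k%:R.
have t1E : k%:R * t1 = i.+1%:R by rewrite mulrC divfK // gt_eqF.
have tt1 : t <= t1 by rewrite ler_pdivlMr // mulrC; case/andP: hi.
have t1t' : t1 <= t' by rewrite ler_pdivrMr // mulrC ltW.
have kN : (k * N)%:R^-1 <= k%:R^-1 :> R.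
  by rewrite lef_pV2 ?posrE ?ltr0n ?muln_gt0 ?s0 ?N0 // ler_nat leq_pmulr.
have b1 : `|cycle_curve f s t - cycle_curve f s t1| < e.
  apply: (@cycle_curve_close1 i) => //; first by rewrite t1E lexx ler_nat leqnSn.
  by rewrite distrC ger0_norm ?subr_ge0 //; lra.
have b2 : `|cycle_curve f s t1 - cycle_curve f s t'| < e.
  apply: (@cycle_curve_close1 i.+1) => //; first by rewrite t1E lexx ler_nat leqnSn.
    rewrite (ltW h2) /=.
    have : t' <= t + k%:R^-1 by lra.
    rewrite -(ler_pM2l kp) mulrDr divff ?gt_eqF // => /le_trans; apply.
    by rewrite -[leRHS]natr1 lerD2r; case/andP: hi.
  by rewrite distrC ger0_norm ?subr_ge0 //; lra.
apply: le_lt_trans (ler_distD (cycle_curve f s t1) _ _) _.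
by move: b1 b2; move: `|_| `|_| => x y; lra.
Qed.

End Curve.
End Cycles.

(** * The linking form *)

Fixpoint path_sum (A : zmodType) (T : Type) (w : T -> T -> A) (p : T) (s : seq T) : A :=
  if s is q :: s' then w p q + path_sum w q s' else 0.

(** The value of a cochain on a closed walk. Written recursively, it unfolds by simplification on
    the explicit cycles used later. *)
Definition cyc (A : zmodType) (T : Type) (w : T -> T -> A) (s : seq T) : A :=
  if s is p :: s' then path_sum w p (rcons s' p) else 0.

Lemma path_sumE (A : zmodType) (T : Type) (w : T -> T -> A) (x0 p : T) (s : seq T) :
  path_sum w p s = \sum_(i < size s) w (nth x0 (p :: s) i) (nth x0 s i).
Proof.
elim: s p => [|q s IH] p /=; first by rewrite big_ord0.
by rewrite big_ord_recl IH.
Qed.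

Lemma cycE (A : zmodType) (T : Type) (p : T) (w : T -> T -> A) (s : seq T) :
  cyc w s = \sum_(i < size s) w (nth p s i) (nth p s (i.+1 %% size s)).
Proof.
case: s => [|q s]; first by rewrite big_ord0.
rewrite /cyc (path_sumE _ p) size_rcons; apply: eq_bigr => i _; congr (w _ _).
  by rewrite -rcons_cons nth_rcons /= ltn_ord.
rewrite nth_rcons; have := ltn_ord i; rewrite ltnS leq_eqVlt => /orP[/eqP e|si].
  by rewrite e ltnn eqxx modnn.
by rewrite si modn_small.
Qed.

Section Linking.
Import numFieldNormedType.Exports.
Local Open Scope classical_set_scope.
Variable R : realType.
Local Notation V := 'rV[R]_3.

Lemma sample_cycle k (f : 'rV[R]_k -> V) s (p0 : 'I_k) i r N : (0 < N)%N ->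
  (i < size s)%N -> (r <= N)%N ->
  sample (cycle_curve f s) (size s * N) (i * N + r) =
  sample (f \o edge_point (nth p0 s i) (nth p0 s (i.+1 %% size s))) N r.
Proof.
move=> N0 ik rN; have s0 : (0 < size s)%N by apply: leq_ltn_trans ik.
have e : (size s)%:R * ((i * N + r)%:R / (size s * N)%:R) = i%:R + r%:R / N%:R :> R.
  by rewrite natrM natrD natrM; field; rewrite !pnatr_eq0 -!lt0n s0 N0.
rewrite /sample (@cycle_curve_edge _ _ _ _ p0 s0 i) // e /=.
  by rewrite addrAC subrr add0r.
rewrite lerDl divr_ge0 ?ler0n //= -natr1 lerD2l ler_pdivrMr ?ltr0n // mul1r.
by rewrite ler_nat.
Qed.

Lemma in_chunk01 (i M : nat) (t : R) : (i < M)%N ->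
  i%:R / M%:R <= t <= i.+1%:R / M%:R -> 0 <= t <= 1.
Proof.
move=> iM /andP[h1 h2]; apply/andP; split.
  by apply: le_trans h1; rewrite divr_ge0.
apply: le_trans h2 _; rewrite ler_pdivrMr ?mul1r ?ler_nat // ltr0n.
exact: leq_ltn_trans iM.
Qed.

Lemma in_chunk_dist (i M : nat) (t t' : R) : (0 < M)%N ->
  i%:R / M%:R <= t <= i.+1%:R / M%:R -> i%:R / M%:R <= t' <= i.+1%:R / M%:R ->
  `|t - t'| <= M%:R^-1.
Proof.
move=> M0; rewrite -natr1 mulrDl mul1r => /andP[h1 h2] /andP[h3 h4].
by rewrite ler_norml; apply/andP; split; lra.
Qed.

Variables (m n : nat) (f : 'rV[R]_m -> V) (g : 'rV[R]_n -> V).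
Hypothesis fg : disjointly_embedded f g.

(** The share of a pair of edges in the grid sum; it may depend on [N], unlike its sums over closed
    walks in fine grids. *)
Definition edge_sum N (u v : 'I_m) (x y : 'I_n) : R :=
  grid (sample (f \o edge_point u v) N) (sample (g \o edge_point x y) N) N N.

(** One [N] serves all pairs of edges: the images are [h] apart, and within a step of length 1 / N
    an edge varies by less than h / 8, as [visible_close] demands. A grid of [size s * N] by
    [size t * N] samples then splits exactly at the vertices. *)
Lemma linking_edge_sum : exists N : nat,
  (forall u v x y, edge_sum N v u x y = - edge_sum N u v x y) /\
  (forall u v x y, edge_sum N u v y x = - edge_sum N u v x y) /\
  forall s t, (0 < size s)%N -> (0 < size t)%N ->
   lk (cycle_curve f s) (cycle_curve g t)
     = (4 * pi)^-1 * cyc (fun u v => cyc (edge_sum N u v) t) s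
   /\ exists k : int, lk (cycle_curve f s) (cycle_curve g t) = k%:~R.
Proof.
have [cf _] : graph_embedding f by case: fg.
have [cg _] : graph_embedding g by case: fg.
have [h h0 hsep] := edges_separated fg.
pose e := h / 8; have e0 : 0 < e by rewrite divr_gt0.
have [N1 N10 hN1] := edges_uniformly_continuous cf e0.
have [N2 N20 hN2] := edges_uniformly_continuous cg e0.
pose N := maxn N1 N2; have N0 : (0 < N)%N by rewrite leq_max N10.
have NN1 : N%:R^-1 <= N1%:R^-1 :> R by rewrite lef_pV2 ?posrE ?ltr0n // ler_nat leq_maxl.
have NN2 : N%:R^-1 <= N2%:R^-1 :> R by rewrite lef_pV2 ?posrE ?ltr0n // ler_nat leq_maxr.
have hf u v (p q : R) : 0 <= p <= 1 -> 0 <= q <= 1 -> `|p - q| <= N%:R^-1 ->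
    `|f (edge_point u v p) - f (edge_point u v q)| < e.
  by move=> hp hq hpq; apply: hN1 => //; apply: le_trans NN1.
have hg u v (p q : R) : 0 <= p <= 1 -> 0 <= q <= 1 -> `|p - q| <= N%:R^-1 ->
    `|g (edge_point u v p) - g (edge_point u v q)| < e.
  by move=> hp hq hpq; apply: hN2 => //; apply: le_trans NN2.
have e8 : 8 * e = h by rewrite /e; field.
have fineE u v x y : fine (f \o edge_point u v) (g \o edge_point x y) N N.
  move=> i j iN jN; apply: (visible_close e0).
  - move=> _ _ [p /= + <-] [q /= + <-]; rewrite !in_itv /= => hp hq.
    apply: lt_trans (hf _ _ _ _ (in_chunk01 iN hp) (in_chunk01 iN hq) (in_chunk_dist N0 hp hq)) _; lra.
  - move=> _ _ [p /= + <-] [q /= + <-]; rewrite !in_itv /= => hp hq.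
    apply: lt_trans (hg _ _ _ _ (in_chunk01 jN hp) (in_chunk01 jN hq) (in_chunk_dist N0 hp hq)) _; lra.
  - move=> _ _ [p /= + <-] [q /= + <-]; rewrite !in_itv /= e8 => hp hq.
    by apply: hsep; [exact: in_chunk01 hp|exact: in_chunk01 hq].
have fineC s t : (0 < size s)%N -> (0 < size t)%N ->
    eventually_fine (cycle_curve f s) (cycle_curve g t) (size s * N) (size t * N).
  move=> s0 t0 M M' hM hM' i j iM jM'.
  have p0 : 'I_m by case: s s0 {hM} => //.
  have q0 : 'I_n by case: t t0 {hM'} => //.
  have M0 : (0 < M)%N by apply: leq_ltn_trans iM.
  have M'0 : (0 < M')%N by apply: leq_ltn_trans jM'.
  have hMR : M%:R^-1 <= (size s * N)%:R^-1 :> R.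
    by rewrite lef_pV2 ?posrE ?ltr0n ?muln_gt0 ?s0 ?N0 // ler_nat.
  have hMR' : M'%:R^-1 <= (size t * N)%:R^-1 :> R.
    by rewrite lef_pV2 ?posrE ?ltr0n ?muln_gt0 ?t0 ?N0 // ler_nat.
  apply: (visible_close e0).
  - move=> _ _ [p /= + <-] [q /= + <-]; rewrite !in_itv /= => hp hq.
    apply: (cycle_curve_close p0 s0 N0 hf (in_chunk01 iM hp) (in_chunk01 iM hq)).
    exact: le_trans (in_chunk_dist M0 hp hq) hMR.
  - move=> _ _ [p /= + <-] [q /= + <-]; rewrite !in_itv /= => hp hq.
    apply: (cycle_curve_close q0 t0 N0 hg (in_chunk01 jM' hp) (in_chunk01 jM' hq)).
    exact: le_trans (in_chunk_dist M'0 hp hq) hMR'.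
  - move=> _ _ [p /= + <-] [q /= + <-]; rewrite !in_itv /= e8 => hp hq.
    have [u [v [r [r01 ->]]]] := cycle_curve_on_edge f p0 s0 (in_chunk01 iM hp).
    have [x [y [r' [r'01 ->]]]] := cycle_curve_on_edge g q0 t0 (in_chunk01 jM' hq).
    exact: hsep.
(* Reversing an edge sends its i-th step to step N - 1 - i with exchanged ends, so antisymmetry
   follows by reindexing from [cell_rev] and [cell_revr]. *)
have revi (i : 'I_N) : 1 - (rev_ord i)%:R / N%:R = i.+1%:R / N%:R :> R.
  rewrite /= natrB // mulrBl divff ?pnatr_eq0 -?lt0n //; ring.
have revi1 (i : 'I_N) : 1 - (rev_ord i).+1%:R / N%:R = i%:R / N%:R :> R.
  rewrite /= subnSK // natrB ?(ltnW (ltn_ord i)) // mulrBl divff ?pnatr_eq0 -?lt0n //; ring.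
have anti_l u v x y : edge_sum N v u x y = - edge_sum N u v x y.
  rewrite /edge_sum /grid (reindex_inj rev_ord_inj) -sumrN; apply: eq_bigr => i _.
  rewrite -sumrN; apply: eq_bigr => j _.
  rewrite {1 2}/sample /= (edge_point_rev u v) (edge_point_rev u v (_.+1%:R / _)).
  rewrite revi revi1.
  have hv := fineE u v x y i j (ltn_ord i) (ltn_ord j).
  apply: (cell_rev hv).
  - by exists (i%:R / N%:R) => //=; rewrite in_itv /= lexx ler_frac // leq_mul2r leqnSn orbT.
  - by exists (i.+1%:R / N%:R) => //=; rewrite in_itv /= lexx ler_frac // leq_mul2r leqnSn orbT.
  - by exists (j%:R / N%:R) => //=; rewrite in_itv /= lexx ler_frac // leq_mul2r leqnSn orbT.
  - by exists (j.+1%:R / N%:R) => //=; rewrite in_itv /= lexx ler_frac // leq_mul2r leqnSn orbT.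
have anti_r u v x y : edge_sum N u v y x = - edge_sum N u v x y.
  rewrite /edge_sum /grid -sumrN; apply: eq_bigr => i _.
  rewrite (reindex_inj rev_ord_inj) -sumrN; apply: eq_bigr => j _.
  rewrite {3 4}/sample /= (edge_point_rev x y) (edge_point_rev x y (_.+1%:R / _)).
  rewrite revi revi1.
  have hv := fineE u v x y i j (ltn_ord i) (ltn_ord j).
  apply: (cell_revr hv).
  - by exists (i%:R / N%:R) => //=; rewrite in_itv /= lexx ler_frac // leq_mul2r leqnSn orbT.
  - by exists (i.+1%:R / N%:R) => //=; rewrite in_itv /= lexx ler_frac // leq_mul2r leqnSn orbT.
  - by exists (j%:R / N%:R) => //=; rewrite in_itv /= lexx ler_frac // leq_mul2r leqnSn orbT.
  - by exists (j.+1%:R / N%:R) => //=; rewrite in_itv /= lexx ler_frac // leq_mul2r leqnSn orbT.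
exists N; split => //; split => // s t s0 t0.
have p0 : 'I_m by case: s s0 => //.
have q0 : 'I_n by case: t t0 => //.
have sN : (0 < size s * N)%N by rewrite muln_gt0 s0.
have tN : (0 < size t * N)%N by rewrite muln_gt0 t0.
have cs := cycle_curve_closed f p0 s0; have ct := cycle_curve_closed g q0 t0.
split; last exact: lk_integral sN tN cs ct (fineC s t s0 t0).
rewrite (lk_curve_grid sN tN cs ct (fineC s t s0 t0) (leqnn _) (leqnn _)); congr (_ * _).
rewrite /curve_grid (@grid_blocks _ _ _
  (fun i => sample (f \o edge_point (nth p0 s i) (nth p0 s (i.+1 %% size s))) N)
  (fun j => sample (g \o edge_point (nth q0 t j) (nth q0 t (j.+1 %% size t))) N)).
- rewrite (cycE p0) //; apply: eq_bigr => i _.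
  by rewrite (cycE q0).
- by move=> i r ik rN; apply: sample_cycle.
by move=> i r ik rN; apply: sample_cycle.
Qed.

End Linking.

(** * Algebra of sums over closed walks *)

Section CyclicSums.
Variables (A : zmodType) (T : Type).
Implicit Types (w : T -> T -> A) (s : seq T).

Lemma eq_cyc w w' s : (forall u v, w u v = w' u v) -> cyc w s = cyc w' s.
Proof.
move=> h; case: s => // p s; rewrite /cyc; move: (rcons s p) => t.
by elim: t p => //= q t IH p; rewrite h IH.
Qed.

Lemma cycD w w' s : cyc (fun u v => w u v + w' u v) s = cyc w s + cyc w' s.
Proof.
case: s => [|p s]; first by rewrite addr0.
by rewrite !(cycE p) -big_split.
Qed.

Lemma cycN w s : cyc (fun u v => - w u v) s = - cyc w s.
Proof.
case: s => [|p s]; first by rewrite oppr0.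
by rewrite !(cycE p) -sumrN.
Qed.

Lemma cyc0 s : cyc (fun _ _ => 0 : A) s = 0.
Proof. by case: s => // p s; rewrite (cycE p) big1. Qed.

Lemma cyc_coboundary (a : T -> A) s : cyc (fun u v => a v - a u) s = 0.
Proof.
case: s => // p s; have h x t : path_sum (fun u v => a v - a u) x t = a (last x t) - a x.
  elim: t x => [|y t IH] x /=; first by rewrite subrr.
  by rewrite IH addrC addrA subrK.
by rewrite /cyc h last_rcons subrr.
Qed.

End CyclicSums.

Lemma cyc_morph (A B : zmodType) (h : A -> B) (T : Type) (w : T -> T -> A) s :
  {morph h : x y / x + y} -> h 0 = 0 -> cyc (fun u v => h (w u v)) s = h (cyc w s).
Proof.
move=> hD h0; case: s => // p s.
by rewrite !(cycE p) (big_morph h hD h0).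
Qed.

Lemma cycZ (A : pzRingType) (c : A) (T : Type) (w : T -> T -> A) s :
  cyc (fun u v => c * w u v) s = c * cyc w s.
Proof. exact: (cyc_morph (h := fun x => c * x) w s (mulrDr c) (mulr0 c)). Qed.

(** Replacing each edge by the triangle it spans with [o] adds the coboundary of [fun v => h v o],
    which vanishes on closed walks. *)
Lemma cyc_cone (A : zmodType) (T : Type) (h : T -> T -> A) (o : T) s :
  (forall u v, h v u = - h u v) -> cyc (fun u v => cyc h [:: o; u; v]) s = cyc h s.
Proof.
move=> hN; rewrite -[RHS]addr0 -[X in _ + X](cyc_coboundary (fun v => h v o) s) -cycD.
apply: eq_cyc => u v /=; rewrite (hN u o) addr0 addrCA; congr (_ + _).
by rewrite addrC.
Qed.

Lemma cycC (A : zmodType) (T U : Type) (w : T -> T -> U -> U -> A) s t :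
  cyc (fun u v => cyc (w u v) t) s = cyc (fun x y => cyc (fun u v => w u v x y) s) t.
Proof.
case: s => [|p s]; first by rewrite cyc0.
case: t => [|q t]; first by rewrite cyc0.
rewrite !(cycE p) (cycE q).
under eq_bigr do rewrite (cycE q).
by rewrite exchange_big; apply: eq_bigr => j _; rewrite (cycE p).
Qed.

Lemma cyc_anti (A : zmodType) (T : Type) (h : T -> T -> A) o u v :
  (forall u v, h v u = - h u v) -> cyc h [:: o; v; u] = - cyc h [:: o; u; v].
Proof.
move=> hN; rewrite /= !addr0 (hN v o) (hN u v) (hN o u) !opprD.
by rewrite addrC -addrA addrCA.
Qed.

(** Only sums of [e] along closed sequences are integers; coning [e] from [o]
    and [o'] changes it by coboundaries and makes its values integers. *)
Lemma integral_form (R : realType) (T U : Type) (e : T -> T -> U -> U -> R) (o : T) (o' : U) :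
  (forall u v x y, e v u x y = - e u v x y) -> (forall u v x y, e u v y x = - e u v x y) ->
  (forall s t, (0 < size s)%N -> (0 < size t)%N ->
     cyc (fun u v => cyc (e u v) t) s \is a Num.int) ->
  exists w : T -> T -> U -> U -> int,
  [/\ forall u v x y, w v u x y = - w u v x y,
      forall u v x y, w u v y x = - w u v x y
    & forall s t, (cyc (fun u v => cyc (w u v) t) s)%:~R = cyc (fun u v => cyc (e u v) t) s].
Proof.
move=> el er eint.
pose c u v x y := cyc (fun u v => cyc (e u v) [:: o'; x; y]) [:: o; u; v].
have cint u v x y : c u v x y \is a Num.int by exact: eint.
have e'N x y u v : cyc (e v u) [:: o'; x; y] = - cyc (e u v) [:: o'; x; y].
  by rewrite -cycN; apply: eq_cyc => ? ?; exact: el.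
have e''N x y u v : cyc (e u v) [:: o'; y; x] = - cyc (e u v) [:: o'; x; y].
  exact/cyc_anti/er.
have cE s t : cyc (fun u v => cyc (c u v) t) s = cyc (fun u v => cyc (e u v) t) s.
  rewrite cycC (eq_cyc (w' := fun x y => cyc (fun u v => cyc (e u v) [:: o'; x; y]) s)).
    rewrite -cycC; apply: eq_cyc => u v; exact/cyc_cone/er.
  by move=> x y; apply: (@cyc_cone _ _ (fun u v => cyc (e u v) [:: o'; x; y])); exact: e'N.
exists (fun u v x y => Num.floor (c u v x y)); split.
- move=> u v x y; apply: (@intr_inj R); rewrite intrN !floorK //.
  exact: (@cyc_anti _ _ (fun u v => cyc (e u v) [:: o'; x; y])).
- move=> u v x y; apply: (@intr_inj R); rewrite intrN !floorK // -cycN.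
  by apply: eq_cyc => ? ?; exact: e''N.
move=> s t; rewrite -cE -(cyc_morph _ _ (@intrD R) (mulr0z _)); apply: eq_cyc => u v.
rewrite -(cyc_morph _ _ (@intrD R) (mulr0z _)); apply: eq_cyc => x y.
by rewrite floorK.
Qed.

Lemma linking_form (R : realType) (m n : nat) (f : 'rV[R]_m -> 'rV[R]_3)
    (g : 'rV[R]_n -> 'rV[R]_3) (o : 'I_m) (o' : 'I_n) :
  disjointly_embedded f g ->
  exists w : 'I_m -> 'I_m -> 'I_n -> 'I_n -> int,
  [/\ forall u v x y, w v u x y = - w u v x y,
      forall u v x y, w u v y x = - w u v x y
    & forall s t, (0 < size s)%N -> (0 < size t)%N ->
      lk (cycle_curve f s) (cycle_curve g t) = (cyc (fun u v => cyc (w u v) t) s)%:~R].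
Proof.
move=> /linking_edge_sum [N [al [ar hL]]].
pose e u v x y := (4 * pi)^-1 * edge_sum f g N u v x y.
have eE s t : cyc (fun u v => cyc (e u v) t) s =
    (4 * pi)^-1 * cyc (fun u v => cyc (edge_sum f g N u v) t) s.
  by rewrite -cycZ; apply: eq_cyc => u v; rewrite -cycZ.
have [] := @integral_form R _ _ e o o'.
- by move=> u v x y; rewrite /e al mulrN.
- by move=> u v x y; rewrite /e ar mulrN.
- by move=> s t s0 t0; rewrite eE; have [<- [k ->]] := hL s t s0 t0; exact: intr_int.
move=> w [wl wr wE]; exists w; split => // s t s0 t0.
by rewrite wE eE; have [->] := hL s t s0 t0.
Qed.

(** * Obstructions on five and six vertices *)

Lemma cyc_map (A : zmodType) (T U : Type) (v : U -> T) (w : T -> T -> A) s :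
  cyc w (map v s) = cyc (fun i j => w (v i) (v j)) s.
Proof.
case: s => // p s; rewrite /cyc /= -map_rcons; move: (rcons s p) => t.
by elim: t p => //= q t IH p; rewrite IH.
Qed.

Lemma eq_in_cyc (A : zmodType) (T : eqType) (w w' : T -> T -> A) s :
  {in s &, forall u v, w u v = w' u v} -> cyc w s = cyc w' s.
Proof.
case: s => // p s h; rewrite !(cycE p); apply: eq_bigr => i _.
by apply: h; apply: mem_nth; rewrite // ltn_mod.
Qed.

(** A cochain supported on the edges at [p] that gives every closed walk the same value as a
    functional linking in the star [pOI]; see [star_form_cyc]. *)
Definition star_weight (T : eqType) (p : T) (O : pred T) (u v : T) : int :=
  Posz ((u == p) && O v) - Posz ((v == p) && O u).

(** [D] confines the cycles to some vertices, so that a contradiction on five or six of them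
    suffices. *)
Definition compatible (T : eqType) (D : pred T) (X W1 W2 : T -> T -> int) : Prop :=
  forall s, uniq s -> (2 < size s)%N -> all D s ->
  [/\ `|cyc X s| <= 1, `|cyc X s + cyc W1 s| <= 1, `|cyc X s + cyc W2 s| <= 1
    & `|cyc X s + cyc W1 s + cyc W2 s| <= 1].

Section Obstructions.
Variables (X : nat -> nat -> int) (b1 b2 : seq bool).
Hypothesis XN : forall i j, X j i = - X i j.
Let W1 := star_weight 0%N (nth false b1).
Let W2 := star_weight 1%N (nth false b2).

(** The bounds X >= -1 and X + 2 <= 1 meet in a single value. The conditions on [s] are boolean, to
    be settled by computation. *)
Lemma compatibleN1 k s : compatible (gtn k) X W1 W2 ->
  [&& uniq s, (2 < size s)%N, all (gtn k) s, cyc W1 s == 1 & cyc W2 s == 1] -> cyc X s = -1.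
Proof.
by move=> h /and5P[us ss sk /eqP e1 /eqP e2]; have [] := h s us ss sk; rewrite e1 e2; move: (cyc X s) => c; rewrite !ler_norml; lia.
Qed.

(** The bounds X + 1 <= 1 and X - 1 >= -1 meet in a single value. *)
Lemma compatible0 k s : compatible (gtn k) X W1 W2 ->
  [&& uniq s, (2 < size s)%N, all (gtn k) s, cyc W1 s == 1 & cyc W2 s == -1] -> cyc X s = 0.
Proof.
by move=> h /and5P[us ss sk /eqP e1 /eqP e2]; have [] := h s us ss sk; rewrite e1 e2; move: (cyc X s) => c; rewrite !ler_norml; lia.
Qed.
End Obstructions.

(** The indices 0 and 1 stand for the apices p1 and p2, and each further vertex
    is labelled by its membership (O or I) in the two stars.  The cycles below
    force a parity contradiction; over the rationals the bounds are
    satisfiable. *)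
Lemma obstruction_OO_OI_IO X : (forall i j, X j i = - X i j) ->
  ~ compatible (gtn 5) X (star_weight 0%N (nth false [:: false; true; true; true; false]))
      (star_weight 1%N (nth false [:: true; false; true; false; true])).
Proof.
move=> XN h.
have [] := h [:: 0; 1; 2]%N isT isT isT.
have [] := h [:: 0; 1; 3]%N isT isT isT.
have [] := h [:: 0; 1; 4]%N isT isT isT.
have [] := h [:: 0; 2; 3]%N isT isT isT.
have [] := h [:: 0; 2; 4]%N isT isT isT.
have [] := h [:: 0; 3; 4]%N isT isT isT.
(* Each edge lies on an even number of the next six cycles, yet [X] is -1 on three of them and 0 on
   the others. *)
have := compatible0 (s := [:: 0; 1; 3; 4]%N) h isT.
have := compatibleN1 (s := [:: 0; 3; 1; 4]%N) h isT.
have := compatible0 (s := [:: 0; 1; 3; 2; 4]%N) h isT.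
have := compatible0 (s := [:: 0; 2; 1; 3; 4]%N) h isT.
have := compatibleN1 (s := [:: 0; 2; 3; 1; 4]%N) h isT.
have := compatibleN1 (s := [:: 0; 3; 1; 2; 4]%N) h isT.
rewrite /star_weight /= !ler_norml.
(* [r] directs every edge from the smaller to the larger index, leaving [lia] one unknown per
   edge. *)
pose r := (XN 0%N 1%N, XN 0%N 2%N, XN 0%N 3%N, XN 0%N 4%N, XN 1%N 2%N, XN 1%N 3%N, XN 1%N 4%N, XN 2%N 3%N, XN 2%N 4%N, XN 3%N 4%N).
rewrite !r; lia.
Qed.

(** Modulo 2 the three longer cycles add up to the triangle 0 1 4, where the bounds also force [X]
    to be 0, while their values 0, -1, 0 have an odd sum. *)
Lemma obstruction_OO_OI_II X : (forall i j, X j i = - X i j) ->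
  ~ compatible (gtn 5) X (star_weight 0%N (nth false [:: false; true; true; true; false]))
      (star_weight 1%N (nth false [:: true; false; true; false; false])).
Proof.
move=> XN h.
have [] := h [:: 0; 1; 2]%N isT isT isT.
have [] := h [:: 0; 1; 3]%N isT isT isT.
have [] := h [:: 0; 1; 4]%N isT isT isT.
have [] := h [:: 0; 2; 3]%N isT isT isT.
have [] := h [:: 0; 2; 4]%N isT isT isT.
have := compatible0 (s := [:: 0; 1; 3; 2; 4]%N) h isT.
have := compatibleN1 (s := [:: 0; 3; 1; 2; 4]%N) h isT.
have := compatible0 (s := [:: 0; 3; 2; 1; 4]%N) h isT.
rewrite /star_weight /= !ler_norml.
pose r := (XN 0%N 1%N, XN 0%N 2%N, XN 0%N 3%N, XN 0%N 4%N, XN 1%N 2%N, XN 1%N 3%N, XN 1%N 4%N, XN 2%N 3%N, XN 2%N 4%N, XN 3%N 4%N).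
rewrite !r; lia.
Qed.

(** The three pentagons again add up modulo 2 to the triangle 0 1 4, on which [X] is 0, and their
    values have an odd sum. *)
Lemma obstruction_OO_IO_II X : (forall i j, X j i = - X i j) ->
  ~ compatible (gtn 5) X (star_weight 0%N (nth false [:: false; true; true; false; false]))
      (star_weight 1%N (nth false [:: true; false; true; true; false])).
Proof.
move=> XN h.
have [] := h [:: 0; 1; 3]%N isT isT isT.
have [] := h [:: 0; 1; 4]%N isT isT isT.
have [] := h [:: 0; 2; 3]%N isT isT isT.
have [] := h [:: 0; 2; 4]%N isT isT isT.
have := compatible0 (s := [:: 0; 1; 4; 2; 3]%N) h isT.
have := compatible0 (s := [:: 0; 2; 3; 1; 4]%N) h isT.
have := compatibleN1 (s := [:: 0; 2; 4; 1; 3]%N) h isT.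
rewrite /star_weight /= !ler_norml.
pose r := (XN 0%N 1%N, XN 0%N 2%N, XN 0%N 3%N, XN 0%N 4%N, XN 1%N 2%N, XN 1%N 3%N, XN 1%N 4%N, XN 2%N 3%N, XN 2%N 4%N, XN 3%N 4%N).
rewrite !r; lia.
Qed.

(** The two quadrilaterals, the pentagon and the triangle 0 1 4 cover each of their edges twice; [X]
    is -1 on one of them and 0 on the rest. *)
Lemma obstruction_OI_IO_II X : (forall i j, X j i = - X i j) ->
  ~ compatible (gtn 5) X (star_weight 0%N (nth false [:: false; true; true; false; false]))
      (star_weight 1%N (nth false [:: true; false; false; true; false])).
Proof.
move=> XN h.
have [] := h [:: 0; 1; 2]%N isT isT isT.
have [] := h [:: 0; 1; 3]%N isT isT isT.
have [] := h [:: 0; 1; 4]%N isT isT isT.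
have [] := h [:: 0; 2; 3]%N isT isT isT.
have := compatible0 (s := [:: 0; 1; 2; 3]%N) h isT.
have := compatibleN1 (s := [:: 0; 2; 1; 3]%N) h isT.
have := compatible0 (s := [:: 0; 2; 3; 1; 4]%N) h isT.
rewrite /star_weight /= !ler_norml.
pose r := (XN 0%N 1%N, XN 0%N 2%N, XN 0%N 3%N, XN 0%N 4%N, XN 1%N 2%N, XN 1%N 3%N, XN 1%N 4%N, XN 2%N 3%N, XN 2%N 4%N, XN 3%N 4%N).
rewrite !r; lia.
Qed.

(** The three longer cycles add up modulo 2 to the triangle 0 1 5, on which [X] is 0, and their
    values have an odd sum. *)
Lemma obstruction_OO_OO_II_II X : (forall i j, X j i = - X i j) ->
  ~ compatible (gtn 6) X (star_weight 0%N (nth false [:: false; true; true; true; false; false]))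
      (star_weight 1%N (nth false [:: true; false; true; true; false; false])).
Proof.
move=> XN h.
have [] := h [:: 0; 1; 2]%N isT isT isT.
have [] := h [:: 0; 1; 5]%N isT isT isT.
have [] := h [:: 0; 2; 3]%N isT isT isT.
have [] := h [:: 0; 2; 4]%N isT isT isT.
have [] := h [:: 0; 3; 5]%N isT isT isT.
have := compatible0 (s := [:: 0; 3; 2; 1; 5]%N) h isT.
have := compatible0 (s := [:: 0; 1; 5; 3; 2; 4]%N) h isT.
have := compatibleN1 (s := [:: 0; 3; 5; 1; 2; 4]%N) h isT.
rewrite /star_weight /= !ler_norml.
pose r := (XN 0%N 1%N, XN 0%N 2%N, XN 0%N 3%N, XN 0%N 4%N, XN 0%N 5%N, XN 1%N 2%N, XN 1%N 3%N, XN 1%N 4%N, XN 1%N 5%N, XN 2%N 3%N, XN 2%N 4%N, XN 2%N 5%N, XN 3%N 4%N, XN 3%N 5%N, XN 4%N 5%N).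
rewrite !r; lia.
Qed.

(** The three quadrilaterals and the hexagon cover each of their edges twice; [X] is -1 on one of
    them and 0 on the rest. *)
Lemma obstruction_OI_OI_IO_IO X : (forall i j, X j i = - X i j) ->
  ~ compatible (gtn 6) X (star_weight 0%N (nth false [:: false; true; true; true; false; false]))
      (star_weight 1%N (nth false [:: true; false; false; false; true; true])).
Proof.
move=> XN h.
have [] := h [:: 0; 1; 2]%N isT isT isT.
have [] := h [:: 0; 1; 3]%N isT isT isT.
have [] := h [:: 0; 1; 5]%N isT isT isT.
have [] := h [:: 0; 2; 4]%N isT isT isT.
have [] := h [:: 0; 3; 5]%N isT isT isT.
have := compatible0 (s := [:: 0; 1; 2; 4]%N) h isT.
have := compatible0 (s := [:: 0; 1; 3; 5]%N) h isT.
have := compatibleN1 (s := [:: 0; 3; 1; 5]%N) h isT.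
have := compatible0 (s := [:: 0; 3; 5; 1; 2; 4]%N) h isT.
rewrite /star_weight /= !ler_norml.
pose r := (XN 0%N 1%N, XN 0%N 2%N, XN 0%N 3%N, XN 0%N 4%N, XN 0%N 5%N, XN 1%N 2%N, XN 1%N 3%N, XN 1%N 4%N, XN 1%N 5%N, XN 2%N 3%N, XN 2%N 4%N, XN 2%N 5%N, XN 3%N 4%N, XN 3%N 5%N, XN 4%N 5%N).
rewrite !r; lia.
Qed.

(** * Stars *)

(** Restriction to the vertices [vs], renamed by their positions: the sides of the stars become
    boolean lists, and the obstructions apply. *)
Lemma compatible_nth (T : eqType) (vs : seq T) (x0 p1 p2 : T) X (O1 O2 : pred T) :
  uniq vs -> (1 < size vs)%N -> nth x0 vs 0 = p1 -> nth x0 vs 1 = p2 ->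
  compatible predT X (star_weight p1 O1) (star_weight p2 O2) ->
  compatible (gtn (size vs)) (fun i j => X (nth x0 vs i) (nth x0 vs j))
    (star_weight 0%N (nth false (map O1 vs))) (star_weight 1%N (nth false (map O2 vs))).
Proof.
move=> uvs svs <- <- h s us ss /allP sk; have vk i : i \in s -> (i < size vs)%N by exact: sk.
have u : uniq (map (nth x0 vs) s).
  rewrite map_inj_in_uniq // => i j /vk hi /vk hj /eqP.
  by rewrite nth_uniq // => /eqP.
have := h (map (nth x0 vs) s) u; rewrite size_map all_predT => /(_ ss isT).
have E k (O : pred T) : (k < size vs)%N ->
  cyc (star_weight (nth x0 vs k) O) (map (nth x0 vs) s)
    = cyc (star_weight k (nth false (map O vs))) s.
  move=> kvs; rewrite cyc_map; apply: eq_in_cyc => i j /vk hi /vk hj.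
  by rewrite /star_weight !nth_uniq // !(nth_map x0).
by rewrite !E ?cyc_map // ltnW.
Qed.

Section Stars.
Variable m : nat.
Implicit Types (p q r a b c : 'I_m) (O I : {set 'I_m}).

Lemma partitionP p O I : ordered_partition p O I ->
  [/\ p \notin O, forall v, (v \in I) = (v != p) && (v \notin O),
      exists v, v \in O & exists v, v \in I].
Proof.
move=> /and4P[/set0Pn O0 /set0Pn I0 dOI /eqP OI].
have h v : (v \in O :|: I)%SET = (v \in [set~ p])%SET by rewrite OI.
split => //; first by have := h p; rewrite !inE eqxx; case: (p \in O).
move=> v; have := h v; rewrite !inE => <-.
have /(_ v) := disjointFr dOI; case: (v \in O) => [/(_ isT) -> //|_].
by rewrite andbT.
Qed.

Lemma mem_star p O I a b c : ([tuple a; b; c] \in star p O I) =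
  [|| [&& a == p, b \in O & c \in I], [&& b == p, c \in O & a \in I]
    | [&& c == p, a \in O & b \in I]].
Proof.
rewrite inE; apply/idP/idP.
  move=> /existsP[q /andP[qO /existsP[r /andP[rI /existsP[[[|[|[|//]]] hk] /=]]]]] /eqP [-> -> ->].
  - by rewrite eqxx qO rI.
  - by rewrite eqxx qO rI !orbT.
  - by rewrite eqxx qO rI !orbT.
move=> /or3P[] /and3P[/eqP -> h1 h2].
- apply/existsP; exists b; rewrite h1; apply/existsP; exists c; rewrite h2 /=.
  by apply/existsP; exists ord0; rewrite /= eqxx.
- apply/existsP; exists c; rewrite h1; apply/existsP; exists a; rewrite h2 /=.
  by apply/existsP; exists (inord 1); rewrite inordK //= eqxx.
- apply/existsP; exists a; rewrite h1; apply/existsP; exists b; rewrite h2 /=.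
  by apply/existsP; exists (inord 2); rewrite inordK //= eqxx.
Qed.

Lemma triple_eta (P : triple m -> Prop) : (forall a b c, P [tuple a; b; c]) -> forall T, P T.
Proof.
move=> h [[|a [|b [|c [|//]]]] //= hs]; have := h a b c; congr (P _); exact: val_inj.
Qed.

Lemma flipE a b c : flip [tuple a; b; c] = [tuple c; b; a].
Proof. exact: val_inj. Qed.

Lemma flip_star p O I T : (flip T \in star p O I) = (T \in star p I O).
Proof.
move: T; apply: triple_eta => a b c; rewrite flipE !mem_star.
by do !case: (_ == _) => //=; rewrite ?orbF ?(andbC (_ \in O)); do !case: (_ \in _).
Qed.

Lemma ordered_partitionC p O I : ordered_partition p O I -> ordered_partition p I O.
Proof. by move=> /and4P[? ? ? ?]; apply/and4P; rewrite finset.setUC disjoint_sym. Qed.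

Lemma star_single_out p q I : star p [set q]%SET I = star q I [set p]%SET.
Proof.
apply/setP; apply: triple_eta => a b c; rewrite !mem_star !inE.
by do !case: (_ == _); do !case: (_ \in _).
Qed.

Lemma ordered_partition_single_out p q I :
  ordered_partition p [set q]%SET I -> ordered_partition q I [set p]%SET.
Proof.
move=> h; have [pq hI _ [v vI]] := partitionP h; move: pq; rewrite inE => pq.
apply/and4P; split.
- by apply/set0Pn; exists v.
- by apply/set0Pn; exists p; rewrite inE.
- by rewrite disjoint_sym disjoints1 hI eqxx.
apply/eqP/setP => u; rewrite !inE hI inE.
by have [->|] := eqVneq u p; rewrite ?pq ?orbT ?orbF.
Qed.

(** A star with a one-element side can be re-expressed with that element as apex. Each excluded
    equality would thus produce a common apex, at [p2], [p1] or [r]. *)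
Lemma no_common_apex p1 O1 I1 p2 O2 I2 :
  ordered_partition p1 O1 I1 -> ordered_partition p2 O2 I2 ->
  ~ common_apex (star p1 O1 I1) (star p2 O2 I2) ->
  [/\ p1 != p2, O1 <> [set p2]%SET, O2 <> [set p1]%SET
    & forall r, I1 = [set r]%SET -> I2 <> [set r]%SET].
Proof.
move=> h1 h2 hn; split.
- by apply/eqP => e; apply: hn; rewrite -e in h2 *; exists p1, O1, I1, O2, I2.
- move=> e; apply: hn; rewrite e star_single_out; exists p2, I1, [set p1]%SET, O2, I2.
  by split => //; apply: ordered_partition_single_out; rewrite -e.
- move=> e; apply: hn; rewrite e star_single_out; exists p1, O1, I1, I2, [set p2]%SET.
  by split => //; apply: ordered_partition_single_out; rewrite -e.
move=> r e1 e2; apply: hn; rewrite e1 e2 -!star_single_out.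
exists r, [set p1]%SET, O1, [set p2]%SET, O2.
split => //; apply/ordered_partitionC/ordered_partition_single_out/ordered_partitionC.
- by rewrite -e1.
- by rewrite -e2.

Qed.

End Stars.

Ltac distinct := rewrite /= !inE !negb_or ?andbT; repeat (apply/andP; split); try done;
  apply/eqP => ?; subst;
  match goal with
  | H1 : is_true (?v \in ?S), H2 : is_true (?v \notin ?S) |- _ => by rewrite H1 in H2
  | H : is_true (?v != ?v) |- _ => by rewrite eqxx in H
  end.

(** * From star functionals to the three cases *)

Section StarForms.
Variable m : nat.
Implicit Types (p q r a b c : 'I_m) (O I : {set 'I_m}) (A : 'I_m -> 'I_m -> int).

Definition star_form A p O I := forall T : triple m, uniq T ->
  cyc A T = if T \in star p O I then 1 else if flip T \in star p O I then -1 else 0.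

(** Triangles through [p] determine an antisymmetric cochain up to a coboundary: since [A] and [W]
    agree on them, A - W is the coboundary of [fun v => A p v - W p v]. *)
Lemma star_form_cyc A p O I s : (forall u v, A v u = - A u v) ->
  ordered_partition p O I -> star_form A p O I ->
  cyc A s = cyc (star_weight p (mem O)) s.
Proof.
move=> AN /partitionP [pO hI _ _] hA; pose W := star_weight p (mem O).
have A0 u : A u u = 0 by have := AN u u; lia.
have WN u v : W v u = - W u v by rewrite /W /star_weight opprB.
have W0 u : W u u = 0 by rewrite /W /star_weight subrr.
rewrite -[RHS]addr0 -[X in _ + X](cyc_coboundary (fun v => A p v - W p v) s) -cycD.
apply: eq_cyc => u v; rewrite -/(W u v).
have [->|up] := eqVneq u p; first by rewrite A0 W0; lia.
have [->|vp] := eqVneq v p; first by rewrite (AN p u) (WN p u) A0 W0; lia.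
have [->|uv] := eqVneq u v; first by rewrite A0 W0; lia.
have := hA [tuple p; u; v]; rewrite flipE !mem_star /= !inE !hI /W /star_weight (AN p v).
rewrite !eqxx !(eq_sym p) (negbTE up) (negbTE vp) (negbTE uv) /=.
by case: (u \in O); case: (v \in O) => /= /(_ isT); lia.
Qed.

(** Vertices off the apices have types OO, OI, IO, II. An OO vertex excludes OI and IO and leads to
    C3; without one, OI and IO both occur, II does not, and one of OI and IO has a single vertex,
    giving C2 or C1. The facts [f1] to [f6] carry the obstructions over to named vertices. *)
Lemma star_pair_cases p1 O1 I1 p2 O2 I2 X :
  ordered_partition p1 O1 I1 -> ordered_partition p2 O2 I2 ->
  ~ common_apex (star p1 O1 I1) (star p2 O2 I2) -> mutually_oriented p1 O1 p2 O2 ->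
  (forall u v, X v u = - X u v) ->
  compatible predT X (star_weight p1 (mem O1)) (star_weight p2 (mem O2)) ->
  [\/ exists p3, C1 p1 O1 I1 p2 O2 I2 p3, exists p3, C2 p1 O1 I1 p2 O2 I2 p3
    | exists p3, C3 p1 O1 I1 p2 O2 I2 p3].
Proof.
move=> h1 h2 hn [p12 p1O2 p2O1] XN hX.
have [_ nO1 nO2 nI] := no_common_apex h1 h2 hn.
have [p1O1 hI1 _ [i1 i1I]] := partitionP h1.
have [p2O2 hI2 _ [i2 i2I]] := partitionP h2.
have F vs : uniq [:: p1, p2 & vs] ->
    compatible (gtn (size vs).+2) (fun i j => X (nth p1 [:: p1, p2 & vs] i) (nth p1 [:: p1, p2 & vs] j))
     (star_weight 0%N (nth false [:: false, true & map (mem O1) vs]))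
     (star_weight 1%N (nth false [:: true, false & map (mem O2) vs])).
  move=> u; have := compatible_nth u isT (x0 := p1) erefl erefl hX.
  by rewrite /= (negbTE p1O1) (negbTE p2O2) p1O2 p2O1.
have XN' vs i j : X (nth p1 vs j) (nth p1 vs i) = - X (nth p1 vs i) (nth p1 vs j) by exact: XN.
have out p q O : p \notin O -> q \in O -> O <> [set q]%SET ->
    exists x, [/\ x != p, x != q & x \in O].
  move=> pO qO nO; have [e|[x]] := set_0Vmem (O :\ q).
    by case: nO; rewrite -(finset.setD1K qO) e finset.setU0.
  rewrite !inE => /andP[xq xO]; exists x; split => //.
  by apply: contraNneq pO => <-.
have [x [xp1 xp2 xO1]] := out _ _ _ p1O1 p2O1 nO1.
have [y [yp2 yp1 yO2]] := out _ _ _ p2O2 p1O2 nO2.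
move: i1I i2I; rewrite hI1 hI2 => /andP[i1p1 i1O1] /andP[i2p2 i2O2].
have i1p2 : i1 != p2 by apply: contraNneq i1O1 => ->.
have i2p1 : i2 != p1 by apply: contraNneq i2O2 => ->.
have f1 a b c : a != p1 -> a != p2 -> b != p1 -> b != p2 -> c != p1 -> c != p2 ->
    a \in O1 -> a \in O2 -> b \in O1 -> b \notin O2 -> c \notin O1 -> c \in O2 -> False.
  move=> a1 a2 b1 b2 c1 c2 aO1 aO2 bO1 bO2 cO1 cO2.
  have u : uniq [:: p1; p2; a; b; c] by distinct.
  have := F [:: a; b; c] u; rewrite /= aO1 aO2 bO1 (negbTE bO2) (negbTE cO1) cO2.
  by apply: obstruction_OO_OI_IO => i j; exact: XN'.
have f2 a b c : a != p1 -> a != p2 -> b != p1 -> b != p2 -> c != p1 -> c != p2 ->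
    a \in O1 -> a \in O2 -> b \in O1 -> b \notin O2 -> c \notin O1 -> c \notin O2 -> False.
  move=> a1 a2 b1 b2 c1 c2 aO1 aO2 bO1 bO2 cO1 cO2.
  have u : uniq [:: p1; p2; a; b; c] by distinct.
  have := F [:: a; b; c] u; rewrite /= aO1 aO2 bO1 (negbTE bO2) (negbTE cO1) (negbTE cO2).
  by apply: obstruction_OO_OI_II => i j; exact: XN'.
have f3 a b c : a != p1 -> a != p2 -> b != p1 -> b != p2 -> c != p1 -> c != p2 ->
    a \in O1 -> a \in O2 -> b \notin O1 -> b \in O2 -> c \notin O1 -> c \notin O2 -> False.
  move=> a1 a2 b1 b2 c1 c2 aO1 aO2 bO1 bO2 cO1 cO2.
  have u : uniq [:: p1; p2; a; b; c] by distinct.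
  have := F [:: a; b; c] u; rewrite /= aO1 aO2 (negbTE bO1) bO2 (negbTE cO1) (negbTE cO2).
  by apply: obstruction_OO_IO_II => i j; exact: XN'.
have f4 a b c : a != p1 -> a != p2 -> b != p1 -> b != p2 -> c != p1 -> c != p2 ->
    a \in O1 -> a \notin O2 -> b \notin O1 -> b \in O2 -> c \notin O1 -> c \notin O2 -> False.
  move=> a1 a2 b1 b2 c1 c2 aO1 aO2 bO1 bO2 cO1 cO2.
  have u : uniq [:: p1; p2; a; b; c] by distinct.
  have := F [:: a; b; c] u; rewrite /= aO1 (negbTE aO2) (negbTE bO1) bO2 (negbTE cO1) (negbTE cO2).
  by apply: obstruction_OI_IO_II => i j; exact: XN'.
have f5 a b c d : a != p1 -> a != p2 -> b != p1 -> b != p2 -> c != p1 -> c != p2 -> d != p1 -> d != p2 ->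
    a \in O1 -> a \in O2 -> b \in O1 -> b \in O2 -> c \notin O1 -> c \notin O2 -> d \notin O1 -> d \notin O2 -> a != b -> c != d -> False.
  move=> a1 a2 b1 b2 c1 c2 d1 d2 aO1 aO2 bO1 bO2 cO1 cO2 dO1 dO2 ab cd.
  have u : uniq [:: p1; p2; a; b; c; d] by distinct.
  have := F [:: a; b; c; d] u; rewrite /= aO1 aO2 bO1 bO2 (negbTE cO1) (negbTE cO2) (negbTE dO1) (negbTE dO2).
  by apply: obstruction_OO_OO_II_II => i j; exact: XN'.
have f6 a b c d : a != p1 -> a != p2 -> b != p1 -> b != p2 -> c != p1 -> c != p2 -> d != p1 -> d != p2 ->
    a \in O1 -> a \notin O2 -> b \in O1 -> b \notin O2 -> c \notin O1 -> c \in O2 -> d \notin O1 -> d \in O2 -> a != b -> c != d -> False.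
  move=> a1 a2 b1 b2 c1 c2 d1 d2 aO1 aO2 bO1 bO2 cO1 cO2 dO1 dO2 ab cd.
  have u : uniq [:: p1; p2; a; b; c; d] by distinct.
  have := F [:: a; b; c; d] u; rewrite /= aO1 (negbTE aO2) bO1 (negbTE bO2) (negbTE cO1) cO2 (negbTE dO1) dO2.
  by apply: obstruction_OI_OI_IO_IO => i j; exact: XN'.
have [/existsP[a /and4P[a1 a2 aO1 aO2]]|/existsPn noOO] :=
    boolP [exists a, [&& a != p1, a != p2, a \in O1 & a \in O2]].
  have e v : v != p1 -> v != p2 -> (v \in O1) = (v \in O2).
    move=> v1 v2; case: (boolP (v \in O1)) => vO1; case: (boolP (v \in O2)) => vO2 //; exfalso.
      case: (boolP (i1 \in O2)) => i1O2.
        exact: (f1 a v i1).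
      exact: (f2 a v i1).
    case: (boolP (i2 \in O1)) => i2O1.
      exact: (f1 a i2 v).
    exact: (f3 a v i2).
  (* Were [i1] the only II vertex, both [I1] and [I2] would be its singleton and it would be a
     common apex. With a second one, [f5] leaves a single OO vertex. *)
  have [/existsP[j /and4P[j1 j2 jO1 ji]]|/existsPn noj] :=
      boolP [exists j, [&& j != p1, j != p2, j \notin O1 & j != i1]]; last first.
    exfalso; have H v : v != p1 -> v != p2 -> (v \notin O1) = (v == i1).
      move=> v1 v2; apply/idP/eqP => [vO1|->//]; apply/eqP.
      by have := noj v; rewrite v1 v2 vO1 negbK.
    apply: (nI i1); apply/setP => v; rewrite inE.
      rewrite hI1; have [->|v1] := eqVneq v p1; first by rewrite eq_sym (negbTE i1p1).
      have [->|v2] := eqVneq v p2; first by rewrite p2O1 eq_sym (negbTE i1p2).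
      exact: H.
    rewrite hI2; have [->|v2] := eqVneq v p2; first by rewrite eq_sym (negbTE i1p2).
    have [->|v1] := eqVneq v p1; first by rewrite p1O2 eq_sym (negbTE i1p1).
    by rewrite -e // H.
  have H v : v != p1 -> v != p2 -> v \in O1 -> v = a.
    move=> v1 v2 vO1; apply/eqP/contraT => va; exfalso.
    by apply: (f5 a v i1 j); rewrite -?e // eq_sym.
  apply: Or33; exists a; split => //; apply/setP => v; rewrite !inE.
    have [->|v2] := eqVneq v p2; first by rewrite p2O1.
    have [->|v1] := eqVneq v p1; first by rewrite (negbTE p1O1) eq_sym (negbTE a1).
    by apply/idP/eqP => [|->//]; exact: H.
  have [->|v1] := eqVneq v p1; first by rewrite p1O2.
  have [->|v2] := eqVneq v p2; first by rewrite (negbTE p2O2) eq_sym (negbTE a2).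
  by rewrite -e //; apply/idP/eqP => [|->//]; exact: H.
(* No vertex has type OO from here on, so [x] is OI and [y] is IO, and [f4] rules out II. *)
have e v : v != p1 -> v != p2 -> v \in O1 -> v \notin O2.
  by move=> v1 v2 vO1; have := noOO v; rewrite v1 v2 vO1.
have xO2 := e x xp1 xp2 xO1.
have yO1 : y \notin O1 by apply: contraL yO2 => /(e y yp1 yp2).
have e' v : v != p1 -> v != p2 -> (v \in O2) = (v \notin O1).
  move=> v1 v2; apply/idP/idP => [|vO1]; first by apply: contraL; exact: e.
  by apply/contraT => vO2; exfalso; exact: (f4 x y v).
(* By [f6], a second IO vertex [z] makes [x] the only OI vertex, which is C2; otherwise [y] is the
   only IO vertex, which is C1. *)
have [/existsP[z /and4P[z1 z2 zO1 zy]]|/existsPn noz] :=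
    boolP [exists z, [&& z != p1, z != p2, z \notin O1 & z != y]].
  have H v : v != p1 -> v != p2 -> v \in O1 -> v = x.
    move=> v1 v2 vO1; apply/eqP/contraT => vx; exfalso.
    by apply: (f6 x v y z); rewrite ?e' ?negbK // eq_sym.
  apply: Or32; exists x; split => //; apply/setP => v; rewrite !inE.
    rewrite hI2; have [->|v2] := eqVneq v p2; first by rewrite eq_sym (negbTE xp2).
    have [->|v1] := eqVneq v p1; first by rewrite p1O2 eq_sym (negbTE xp1).
    by rewrite e' // negbK; apply/idP/eqP => [|->//]; exact: H.
  have [->|v2] := eqVneq v p2; first by rewrite p2O1.
  have [->|v1] := eqVneq v p1; first by rewrite (negbTE p1O1) eq_sym (negbTE xp1).
  by apply/idP/eqP => [|->//]; exact: H.
have H v : v != p1 -> v != p2 -> (v \notin O1) = (v == y).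
  move=> v1 v2; apply/idP/eqP => [vO1|->//]; apply/eqP.
  by have := noz v; rewrite v1 v2 vO1 negbK.
apply: Or31; exists y; split => //; apply/setP => v; rewrite !inE.
  rewrite hI1; have [->|v1] := eqVneq v p1; first by rewrite eq_sym (negbTE yp1).
  have [->|v2] := eqVneq v p2; first by rewrite p2O1 eq_sym (negbTE yp2).
  exact: H.
have [->|v1] := eqVneq v p1; first by rewrite p1O2.
have [->|v2] := eqVneq v p2; first by rewrite (negbTE p2O2) eq_sym (negbTE yp2).
by rewrite e' // H.
Qed.

End StarForms.

(** * Joining two triangles *)

Ltac uniq_from_neq :=
  rewrite /= !inE !negb_or ?andbT; repeat (apply/andP; split); rewrite // eq_sym.

Ltac is_cycle_from_neq :=
  rewrite /is_cycle /= !inE !negb_or ?andbT; repeat (apply/andP; split); rewrite // eq_sym.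

Ltac split_neq H := repeat match goal with
  | H : is_true (_ && _) |- _ => let H1 := fresh "N" in let H2 := fresh "N" in
     case/andP: H => H1 H2 end.

Section Connector.
Variables (m n : nat) (w : 'I_m -> 'I_m -> 'I_n -> 'I_n -> int).
Hypothesis wl : forall u v x y, w v u x y = - w u v x y.
Hypothesis wr : forall u v x y, w u v y x = - w u v x y.
Hypothesis weak : forall s t, is_cycle s -> is_cycle t ->
  `|cyc (fun u v => cyc (w u v) t) s| <= 1.
Implicit Types (X A B h : 'I_m -> 'I_m -> int) (a b c d e : 'I_n).

Definition link_form (t : seq 'I_n) u v : int := cyc (w u v) t.

Definition cycle_bounded h := forall s, is_cycle s -> `|cyc h s| <= 1.

Lemma link_form_bounded t : is_cycle t -> cycle_bounded (link_form t).
Proof. by move=> ht s hs; exact: weak. Qed.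

Lemma eq_cycle_bounded h h' : (forall u v, h u v = h' u v) -> cycle_bounded h' -> cycle_bounded h.
Proof. by move=> e b s hs; rewrite (eq_cyc s e) b. Qed.

Lemma cycle_boundedN h : cycle_bounded h -> cycle_bounded (fun u v => - h u v).
Proof. by move=> b s hs; rewrite cycN normrN b. Qed.

Lemma cycle_bounded0 : cycle_bounded (fun _ _ => 0).
Proof. by move=> s hs; rewrite cyc0 normr0. Qed.

(** [X] is the linking with a cycle of K_n that can be merged with either of two
    triangles, or with both, into a single cycle. *)
Definition connected A B := exists X, (forall u v, X v u = - X u v) /\ compatible predT X A B.

Lemma connectedI X A B : (forall u v, X v u = - X u v) ->
  cycle_bounded X -> cycle_bounded (fun u v => X u v + A u v) ->
  cycle_bounded (fun u v => X u v + B u v) ->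
  cycle_bounded (fun u v => X u v + A u v + B u v) -> connected A B.
Proof.
move=> XN h h1 h2 h3; exists X; split => // s us ss _.
have cs : is_cycle s by rewrite /is_cycle us ss.
split; first exact: h.
- by rewrite -cycD; exact: h1.
- by rewrite -cycD; exact: h2.
- by rewrite -!cycD; exact: h3.
Qed.

Lemma link_formN t u v : link_form t v u = - link_form t u v.
Proof. by rewrite /link_form -cycN; apply: eq_cyc => x y; rewrite wl. Qed.

(** The quadrilateral [a c d f] runs along one edge of each triangle in the opposite direction, so
    adding a triangle replaces that edge by the detour through [b] or [e]. *)
Lemma connected_disjoint a b c d e f : uniq [:: a; b; c; d; e; f] ->
  connected (link_form [:: a; b; c]) (link_form [:: d; e; f]).
Proof.
rewrite /= !inE !negb_or => H; split_neq H.
apply: (connectedI (X := link_form [:: a; c; d; f])); first exact: link_formN.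
- by apply: link_form_bounded; is_cycle_from_neq.
- apply: (@eq_cycle_bounded _ (link_form [:: a; b; c; d; f])) => [u v|].
    by rewrite /link_form /= (wr u v a c); ring.
  by apply: link_form_bounded; is_cycle_from_neq.
- apply: (@eq_cycle_bounded _ (link_form [:: a; c; d; e; f])) => [u v|].
    by rewrite /link_form /= (wr u v d f); ring.
  by apply: link_form_bounded; is_cycle_from_neq.
- apply: (@eq_cycle_bounded _ (link_form [:: a; b; c; d; e; f])) => [u v|].
    by rewrite /link_form /= (wr u v a c) (wr u v d f); ring.
  by apply: link_form_bounded; is_cycle_from_neq.
Qed.

(** The triangle [a c d] does the same: it runs along an edge of each given triangle in the opposite
    direction. *)
Lemma connected_vertex a b c d e : uniq [:: a; b; c; d; e] ->
  connected (link_form [:: a; b; c]) (link_form [:: a; d; e]).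
Proof.
rewrite /= !inE !negb_or => H; split_neq H.
apply: (connectedI (X := link_form [:: a; c; d])); first exact: link_formN.
- by apply: link_form_bounded; is_cycle_from_neq.
- apply: (@eq_cycle_bounded _ (link_form [:: a; b; c; d])) => [u v|].
    by rewrite /link_form /= (wr u v a c); ring.
  by apply: link_form_bounded; is_cycle_from_neq.
- apply: (@eq_cycle_bounded _ (link_form [:: a; c; d; e])) => [u v|].
    by rewrite /link_form /= (wr u v a d); ring.
  by apply: link_form_bounded; is_cycle_from_neq.
- apply: (@eq_cycle_bounded _ (link_form [:: a; b; c; d; e])) => [u v|].
    by rewrite /link_form /= (wr u v a c) (wr u v a d); ring.
  by apply: link_form_bounded; is_cycle_from_neq.
Qed.

(** The common edge already cancels in the sum, so X = 0 will do. *)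
Lemma connected_edge_opp a b c d : uniq [:: a; b; c; d] ->
  connected (link_form [:: a; b; c]) (link_form [:: b; a; d]).
Proof.
rewrite /= !inE !negb_or => H; split_neq H.
apply: (connectedI (X := fun _ _ => 0)); first by move=> *; rewrite oppr0.
- exact: cycle_bounded0.
- apply: (@eq_cycle_bounded _ (link_form [:: a; b; c])) => [u v|]; first by rewrite add0r.
  by apply: link_form_bounded; is_cycle_from_neq.
- apply: (@eq_cycle_bounded _ (link_form [:: b; a; d])) => [u v|]; first by rewrite add0r.
  by apply: link_form_bounded; is_cycle_from_neq.
- apply: (@eq_cycle_bounded _ (link_form [:: b; c; a; d])) => [u v|].
    by rewrite /link_form /= (wr u v a b); ring.
  by apply: link_form_bounded; is_cycle_from_neq.
Qed.

(** Here the sum is not a cycle but the difference is; with X = -B the four functionals are -B, A -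
    B, 0 and A. *)
Lemma connected_edge a b c d : uniq [:: a; b; c; d] ->
  connected (link_form [:: a; b; c]) (link_form [:: a; b; d]).
Proof.
rewrite /= !inE !negb_or => H; split_neq H.
apply: (connectedI (X := fun u v => - link_form [:: a; b; d] u v)).
- by move=> u v; rewrite link_formN.
- apply/cycle_boundedN/link_form_bounded.
  by is_cycle_from_neq.
- apply: (@eq_cycle_bounded _ (link_form [:: b; c; a; d])) => [u v|].
    by rewrite /link_form /= (wr u v b d) (wr u v a d); ring.
  by apply: link_form_bounded; is_cycle_from_neq.
- apply: (@eq_cycle_bounded _ (fun _ _ => 0)) => [u v|]; first by rewrite addNr.
  exact: cycle_bounded0.
- apply: (@eq_cycle_bounded _ (link_form [:: a; b; c])) => [u v|]; first by ring.
  by apply: link_form_bounded; is_cycle_from_neq.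
Qed.

Lemma link_form_rot a b c : link_form [:: b; c; a] = link_form [:: a; b; c].
Proof. by apply/funext => u; apply/funext => v; rewrite /link_form /=; ring. Qed.

Lemma link_form_rev a b c u v : link_form [:: c; b; a] u v = - link_form [:: a; b; c] u v.
Proof. by rewrite /link_form /= (wr u v b c) (wr u v a b) (wr u v c a); ring. Qed.

Lemma triangles_connected (T1 T2 : triple n) : uniq T1 -> uniq T2 ->
  [\/ connected (link_form T1) (link_form T2), link_form T2 = link_form T1
    | forall u v, link_form T2 u v = - link_form T1 u v].
Proof.
pose P A B := [\/ connected A B, B = A | forall u v, B u v = - A u v].
rewrite -/(P _ _); move: T1 T2; apply: triple_eta => a b c; apply: triple_eta => d e f.
have rotl x y z B : P (link_form [:: y; z; x]) B -> P (link_form [:: x; y; z]) B.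
  by rewrite -(link_form_rot x y z).
have rotr x y z A : P A (link_form [:: y; z; x]) -> P A (link_form [:: x; y; z]).
  by rewrite -(link_form_rot x y z).
rewrite /= !inE !negb_or !andbT => /andP[/andP[ab ac] bc] /andP[/andP[de df] ef].
have [da|da] := eqVneq d a; [|have [db|db] := eqVneq d b; [|have [dc|dc] := eqVneq d c]].
all: have [ea|ea] := eqVneq e a; [|have [eb|eb] := eqVneq e b; [|have [ec|ec] := eqVneq e c]].
all: have [fa|fa] := eqVneq f a; [|have [fb|fb] := eqVneq f b; [|have [fc|fc] := eqVneq f c]].
all: subst; try by match goal with H : is_true (?v != ?v) |- _ => rewrite eqxx in H end.
(* Every coincidence pattern matches one of these branches once one or both triples have been
   rotated. *)
all: let base := idtac; match goal with
  | |- ?Q ?A ?A => by apply: Or32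
  | |- ?Q (link_form [:: ?x; ?y; ?z]) (link_form [:: ?z; ?y; ?x]) =>
      by apply: Or33; exact: link_form_rev
  | |- ?Q (link_form [:: ?x; ?y; _]) (link_form [:: ?x; ?y; _]) =>
      by apply: Or31; apply: connected_edge; uniq_from_neq
  | |- ?Q (link_form [:: ?x; ?y; _]) (link_form [:: ?y; ?x; _]) =>
      by apply: Or31; apply: connected_edge_opp; uniq_from_neq
  | |- ?Q (link_form [:: ?x; _; _]) (link_form [:: ?x; _; _]) =>
      by apply: Or31; apply: connected_vertex; uniq_from_neq
  | |- _ => by apply: Or31; apply: connected_disjoint; uniq_from_neq end in
  let turnr := first [base | apply rotr; base | apply rotr; apply rotr; base] in
  first [turnr | apply rotl; turnr | apply rotl; apply rotl; turnr].
Qed.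

End Connector.

(** * Unions of two stars *)

Ltac set_perm := by apply/setP => ?; rewrite !inE; do !case: (_ == _).

Section Unions.
Variable m : nat.
Implicit Types (p q r a b c u v x : 'I_m) (O I t : {set 'I_m}).

Lemma set3CA a b c : [set a; b; c]%SET = [set b; a; c]%SET.
Proof. by apply/setP => z; rewrite !inE [(z == a) || _]orbC. Qed.

Lemma set3AC a b c : [set a; b; c]%SET = [set a; c; b]%SET.
Proof. by apply/setP => z; rewrite !inE -!orbA [(z == b) || _]orbC. Qed.

Lemma card_set3 a b c : a != b -> a != c -> b != c -> #|[set a; b; c]%SET| = 3%N.
Proof. by move=> ab ac bc; rewrite -finset.setUA cardsU1 cards2 !inE negb_or ab ac bc. Qed.

Lemma mem_unoriented_star p O I t : reflect
  (exists q r, [/\ q \in O, r \in I & t = [set p; q; r]%SET]) (t \in unoriented (star p O I)).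
Proof.
have hs a b c : [set x in [tuple a; b; c]]%SET = [set a; b; c]%SET.
  by apply/setP => z; rewrite !inE orbA.
apply: (iffP imsetP) => [[]|[q [r [qO rI ->]]]]; last first.
  by exists [tuple p; q; r]; rewrite ?hs // mem_star eqxx qO rI.
apply: triple_eta => a b c; rewrite mem_star hs => /or3P[] /and3P[/eqP -> h1 h2] ->.
- by exists b, c.
- by exists c, a; split => //; set_perm.
- by exists a, b; split => //; set_perm.
Qed.

(** [x] may be the remaining vertex of the base triangle, so the base triangle itself is counted. *)
Lemma mem_triangles_sharing_edge a b c t : a != b -> a != c -> b != c -> reflect
  (exists x, [\/ [/\ x != a, x != b & t = [set a; b; x]%SET],
                 [/\ x != a, x != c & t = [set a; c; x]%SET]
               | [/\ x != b, x != c & t = [set b; c; x]%SET]])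
  (t \in triangles_sharing_edge [set a; b; c]%SET).
Proof.
move=> ab ac bc.
have intro u v x : u != v -> x != u -> x != v -> u \in [set a; b; c]%SET ->
    v \in [set a; b; c]%SET -> [set u; v; x]%SET \in triangles_sharing_edge [set a; b; c]%SET.
  move=> uv xu xv ut vt; have c3 : #|[set u; v; x]%SET| = 3%N.
    by apply: card_set3; rewrite // eq_sym.
  rewrite inE c3 eqxx /=.
  apply/existsP; exists u; apply/existsP; exists v; rewrite uv /= !finset.subUset !finset.sub1set ut vt.
  by rewrite !inE !eqxx ?orbT.
apply: (iffP idP) => [|[x [] [h1 h2 ->]]]; last 3 first.
- by apply: intro; rewrite ?inE ?eqxx ?orbT.
- by apply: intro; rewrite ?inE ?eqxx ?orbT.
- by apply: intro; rewrite ?inE ?eqxx ?orbT.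
rewrite inE => /andP[/eqP t3 /existsP[u /existsP[v /and3P[uv]]]].
rewrite !finset.subUset !finset.sub1set => /andP[ut vt] /andP[u0 v0].
have [x xt [xu xv]] : exists2 x, t = [set u; v; x]%SET & x != u /\ x != v.
  have : #|t :\ u :\ v| == 1%N.
    have := cardsD1 u t; have := cardsD1 v (t :\ u)%SET; rewrite t3 ut !inE eq_sym uv vt /=; lia.
  move=> /cards1P[x e]; have : x \in (t :\ u :\ v)%SET by rewrite e inE.
  rewrite !inE => /and3P[xv xu xt]; exists x => //.
  have vt' : v \in (t :\ u)%SET by rewrite !inE eq_sym uv.
  by rewrite -(finset.setD1K ut) -(finset.setD1K vt') e finset.setUA.
exists x; move: uv xt xu xv; move: u0 v0; rewrite !inE -!orbA => /or3P[] /eqP -> /or3P[] /eqP ->.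
all: rewrite ?eqxx // => _ -> xu xv.
- by apply: Or31; split.
- by apply: Or32; split.
- by apply: Or31; split => //; set_perm.
- by apply: Or33; split.
- by apply: Or32; split => //; set_perm.
- by apply: Or33; split => //; set_perm.
Qed.

(** The first star consists of all triangles on the edge [p1 p3], the base triangle included; the
    second adds those on [p1 p2] and [p2 p3] with third vertex off the base triangle. *)
Lemma union_C1 p1 O1 I1 p2 O2 I2 p3 :
  ordered_partition p1 O1 I1 -> ordered_partition p2 O2 I2 ->
  mutually_oriented p1 O1 p2 O2 -> C1 p1 O1 I1 p2 O2 I2 p3 ->
  unoriented (star p1 O1 I1 :|: star p2 O2 I2)%SET = triangles_sharing_edge [set p1; p2; p3]%SET.
Proof.
move=> h1 h2 [p12 p1O2 p2O1] [p31 p32 I1E O2E].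
have [p1O1 hI1 _ _] := partitionP h1; have [p2O2 hI2 _ _] := partitionP h2.
have O1E v : (v \in O1) = (v != p1) && (v != p3).
  have := hI1 v; rewrite I1E inE; have [->|] := eqVneq v p1; first by rewrite (negbTE p1O1).
  by move=> _ ->; rewrite negbK.
have I2E v : (v \in I2) = [&& v != p2, v != p1 & v != p3] by rewrite hI2 O2E !inE negb_or.
apply/setP => t; rewrite /unoriented imsetU inE.
rewrite eq_sym in p31; rewrite eq_sym in p32.
apply/orP/(mem_triangles_sharing_edge _ p12 p31 p32) => [[]/mem_unoriented_star|[x]].
- move=> [q [r []]]; rewrite O1E I1E inE => /andP[q1 q3] /eqP -> ->.
  by exists q; apply: Or32; split => //; rewrite set3AC.
- move=> [q [r []]]; rewrite O2E I2E !inE => /orP[]/eqP -> /and3P[r2 r1 r3] ->.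
    by exists r; apply: Or31; split => //; rewrite set3CA.
  by exists r; apply: Or33.
case=> [[x1 x2 ->]|[x1 x3 ->]|[x2 x3 ->]].
- have [->|x3] := eqVneq x p3.
    by left; apply/mem_unoriented_star; exists p2, p3; rewrite O1E I1E inE eqxx p32 eq_sym p12.
  right; apply/mem_unoriented_star; exists p1, x.
  by rewrite O2E I2E !inE eqxx x1 x2 x3 set3CA.
- left; apply/mem_unoriented_star; exists x, p3.
  by rewrite O1E I1E inE x1 x3 eqxx set3AC.
have [->|x1] := eqVneq x p1.
  left; apply/mem_unoriented_star; exists p2, p3.
  by rewrite O1E I1E inE eqxx p32 eq_sym p12; split => //; set_perm.
right; apply/mem_unoriented_star; exists p3, x.
by rewrite O2E I2E !inE eqxx x1 x2 x3 orbT.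
Qed.

(** Each star covers two edges of the base triangle, always with third vertex off it, since [p1],
    [p2], [p3] all avoid [I1] and [I2]. *)
Lemma union_C3 p1 O1 I1 p2 O2 I2 p3 :
  ordered_partition p1 O1 I1 -> ordered_partition p2 O2 I2 ->
  mutually_oriented p1 O1 p2 O2 -> C3 p1 O1 I1 p2 O2 I2 p3 ->
  unoriented (star p1 O1 I1 :|: star p2 O2 I2)%SET
    = (triangles_sharing_edge [set p1; p2; p3] :\ [set p1; p2; p3])%SET.
Proof.
move=> h1 h2 [p12 p1O2 p2O1] [p31 p32 O1E O2E].
have [p1O1 hI1 _ _] := partitionP h1; have [p2O2 hI2 _ _] := partitionP h2.
have I1E v : (v \in I1) = [&& v != p1, v != p2 & v != p3] by rewrite hI1 O1E !inE negb_or.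
have I2E v : (v \in I2) = [&& v != p2, v != p1 & v != p3] by rewrite hI2 O2E !inE negb_or.
apply/setP => t; rewrite /unoriented imsetU finset.in_setU finset.in_setD1.
rewrite eq_sym in p31; rewrite eq_sym in p32.
have ne u v x : x != p1 -> x != p2 -> x != p3 -> [set u; v; x]%SET != [set p1; p2; p3]%SET.
  move=> x1 x2 x3; apply/eqP => /setP /(_ x).
  by rewrite !inE eqxx orbT (negbTE x1) (negbTE x2) (negbTE x3).
have tP := mem_triangles_sharing_edge t p12 p31 p32.
apply/orP/andP => [h|[tT /tP [x]]].
  have [u [v [x [x1 x2 x3 uv]]]] : exists u v x, [/\ x != p1, x != p2, x != p3 &
      [\/ u = p1 /\ v = p2, u = p1 /\ v = p3 | u = p2 /\ v = p3] /\ t = [set u; v; x]%SET].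
    case: h => /mem_unoriented_star [q [r []]].
      rewrite O1E I1E !inE => /orP[]/eqP -> /and3P[r1 r2 r3] ->.
        by exists p1, p2, r; split => //; split => //; apply: Or31.
      by exists p1, p3, r; split => //; split => //; apply: Or32.
    rewrite O2E I2E !inE => /orP[]/eqP -> /and3P[r1 r2 r3] ->.
      by exists p1, p2, r; rewrite set3CA; split => //; split => //; apply: Or31.
    by exists p2, p3, r; split => //; split => //; apply: Or33.
  move: uv => [uv ->]; split; first exact: ne.
  apply/mem_triangles_sharing_edge => //; exists x.
  by case: uv => -[-> ->]; [apply: Or31|apply: Or32|apply: Or33].
move=> H; have x3 : [/\ x != p1, x != p2 & x != p3].
  move: tT; case: H => [[xa xb ->]|[xa xb ->]|[xa xb ->]] T; split => //.
  - by apply: contraNneq T => ->.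
  - by apply: contraNneq T => ->; rewrite set3AC.
  - by apply: contraNneq T => ->; apply/eqP; set_perm.
move: x3 => [x1 x2 x3]; case: H => [[_ _ ->]|[_ _ ->]|[_ _ ->]].
- left; apply/mem_unoriented_star; exists p2, x.
  by rewrite O1E I1E !inE eqxx x1 x2 x3.
- left; apply/mem_unoriented_star; exists p3, x.
  by rewrite O1E I1E !inE eqxx x1 x2 x3 orbT.
right; apply/mem_unoriented_star; exists p3, x.
by rewrite O2E I2E !inE eqxx x1 x2 x3 orbT.
Qed.

Lemma union_C2 p1 O1 I1 p2 O2 I2 p3 :
  ordered_partition p1 O1 I1 -> ordered_partition p2 O2 I2 ->
  mutually_oriented p1 O1 p2 O2 -> C2 p1 O1 I1 p2 O2 I2 p3 ->
  unoriented (star p1 O1 I1 :|: star p2 O2 I2)%SET = triangles_sharing_edge [set p1; p2; p3]%SET.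
Proof.
move=> h1 h2 [p12 p1O2 p2O1] [p31 p32 I2E O1E].
rewrite finset.setUC set3CA; apply: union_C1 h2 h1 _ _; first by split; rewrite // eq_sym.
by split.
Qed.

(** C1 and C2 together would leave no vertices but [p1], [p2], [a], [b], against [m5]. If C3 held
    with C1 or C2, the third vertices would coincide and lie on both sides of one star. *)
Lemma exactly_one_case (m5 : (5 <= m)%N) p1 O1 I1 p2 O2 I2 :
  ordered_partition p1 O1 I1 -> ordered_partition p2 O2 I2 ->
  [\/ exists p3, C1 p1 O1 I1 p2 O2 I2 p3, exists p3, C2 p1 O1 I1 p2 O2 I2 p3
    | exists p3, C3 p1 O1 I1 p2 O2 I2 p3] ->
  exactly_one (exists p3, C1 p1 O1 I1 p2 O2 I2 p3) (exists p3, C2 p1 O1 I1 p2 O2 I2 p3)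
    (exists p3, C3 p1 O1 I1 p2 O2 I2 p3).
Proof.
move=> /partitionP[p1O1 hI1 _ _] /partitionP[p2O2 hI2 _ _].
have n12 : (exists p3, C1 p1 O1 I1 p2 O2 I2 p3) -> ~ (exists p3, C2 p1 O1 I1 p2 O2 I2 p3).
  move=> [a [a1 a2 I1E O2E]] [b [b1 b2 I2E O1E]].
  have : (#|[set: 'I_m]| <= #|[set p1; p2] :|: [set a; b]|)%N.
    apply: subset_leq_card; apply/fintype.subsetP => v _; have := hI1 v; rewrite I1E O1E !inE.
    by case: (v == p1); case: (v == p2); case: (v == b); case: (v == a).
  rewrite cardsT card_ord => h; have := leq_trans m5 (leq_trans h (leq_of_leqif (leq_card_setU _ _))).
  by rewrite !cards2; case: (_ != _); case: (_ != _).
have n13 : (exists p3, C1 p1 O1 I1 p2 O2 I2 p3) -> ~ (exists p3, C3 p1 O1 I1 p2 O2 I2 p3).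
  move=> [a [a1 a2 I1E O2E]] [b [b1 b2 O1E O2E']].
  have := hI1 a; have : a \in [set p1; b] by rewrite -O2E' O2E !inE eqxx orbT.
  by rewrite I1E O1E !inE eqxx (negbTE a1) /= => /eqP ->; rewrite eqxx orbT.
have n23 : (exists p3, C2 p1 O1 I1 p2 O2 I2 p3) -> ~ (exists p3, C3 p1 O1 I1 p2 O2 I2 p3).
  move=> [a [a1 a2 I2E O1E]] [b [b1 b2 O1E' O2E]].
  have := hI2 a; have : a \in [set p2; b] by rewrite -O1E' O1E !inE eqxx orbT.
  by rewrite I2E O2E !inE eqxx (negbTE a2) /= => /eqP ->; rewrite eqxx orbT.
by case=> h; [apply: Or31|apply: Or32|apply: Or33]; split => // h'; [exact: n12 h h'|exact: n13 h h'|
  exact: n12 h' h|exact: n23 h h'|exact: n13 h' h|exact: n23 h' h].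
Qed.

End Unions.

(** * Conclusion *)

Section StarUniqueness.
Variable m : nat.
Implicit Types (p : 'I_m) (O I : {set 'I_m}) (A : 'I_m -> 'I_m -> int).

Lemma star_uniq p O I (T : triple m) : ordered_partition p O I -> T \in star p O I ->
  uniq T /\ flip T \notin star p O I.
Proof.
move=> /partitionP [pO hI _ _].
have H a b : a \in O -> b \in I ->
    [/\ (a == p) = false, (b == p) = false, (a == b) = false, (a \in I) = false & (b \in O) = false].
  move=> aO; rewrite hI => /andP[bp bO]; rewrite hI aO andbF; split => //; apply/negbTE => //.
    by apply: contraNneq pO => <-.
  by apply: contraNneq bO => <-.
move: T; apply: triple_eta => a b c; rewrite flipE !mem_star /= !inE.
move=> /or3P[] /and3P[/eqP -> h1 h2]; have [e1 e2 e3 e4 e5] := H _ _ h1 h2.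
- by rewrite (eq_sym p b) (eq_sym p c) e1 e2 e3 ?e4 ?e5 ?andbF.
- by rewrite (eq_sym a c) (eq_sym p c) e1 e2 e3 ?e4 ?e5 ?andbF.
- by rewrite e1 e2 e3 ?e4 ?e5 ?andbF.
Qed.

Lemma star_formN A p O I : ordered_partition p O I -> star_form A p O I ->
  star_form (fun u v => - A u v) p I O.
Proof.
move=> h hA T uT; rewrite cycN hA // -(flip_star p O I T) -(flip_star p O I (flip T)).
have -> : flip (flip T) = T by apply: val_inj; rewrite /= revK.
case: ifP => [/(star_uniq h) [_ /negbTE ->] //|_].
by case: ifP => // _; rewrite opprK.
Qed.

(** A star is recovered from its functional as the set of triples where the value is 1. *)
Lemma star_form_inj A A' p O I p' O' I' : (forall u v, A u v = A' u v) ->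
  ordered_partition p O I -> ordered_partition p' O' I' ->
  star_form A p O I -> star_form A' p' O' I' -> star p O I = star p' O' I'.
Proof.
have sub B q Q J (T : triple m) : star_form B q Q J -> uniq T -> cyc B T = 1 -> T \in star q Q J.
  by move=> hB uT; rewrite (hB T uT); case: ifP => // _; case: ifP.
have one B q Q J (T : triple m) : star_form B q Q J -> uniq T -> T \in star q Q J -> cyc B T = 1.
  by move=> hB uT hT; rewrite (hB T uT) hT.
move=> e h h' hA hA'; apply/setP => T; have eT := eq_cyc T e.
apply/idP/idP => hT.
  have [uT _] := star_uniq h hT.
  by apply: (sub _ _ _ _ _ hA' uT); rewrite -eT; exact: one hA uT hT.
have [uT _] := star_uniq h' hT.
by apply: (sub _ _ _ _ _ hA uT); rewrite eT; exact: one hA' uT hT.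
Qed.

Lemma common_apexC (S1 S2 : {set triple m}) : common_apex S1 S2 -> common_apex S2 S1.
Proof. by move=> [p [Q [J [Q2 [J2 [? ? ? ?]]]]]]; exists p, Q2, J2, Q, J. Qed.

Lemma common_apex_flip p O I (S : {set triple m}) :
  common_apex (star p I O) S -> common_apex (star p O I) S.
Proof.
move=> [q [Q [J [Q2 [J2 [h1 h2 e1 e2]]]]]]; exists q, J, Q, Q2, J2; split => //.
  exact: ordered_partitionC.
by apply/setP => T; rewrite -flip_star e1 flip_star.
Qed.

End StarUniqueness.

Lemma links_in_starP (R : realType) (m n : nat) (f : 'rV[R]_m -> 'rV[R]_3)
    (g : 'rV[R]_n -> 'rV[R]_3) w (T : triple n) p O I :
  (forall s t, (0 < size s)%N -> (0 < size t)%N ->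
      lk (cycle_curve f s) (cycle_curve g t) = (cyc (fun u v => cyc (w u v) t) s)%:~R) ->
  links_in_star (cycle_curve g T) f (star p O I) <-> star_form (link_form w T) p O I.
Proof.
move=> wE; have E (T' : triple m) : lk (cycle_curve g T) (cycle_curve f T') = (cyc (link_form w T) T')%:~R.
  by rewrite lkC wE // size_tuple.
split => h T' uT'; have := h T' uT'; last by rewrite E => ->; case: ifP => // _; case: ifP.
rewrite E => e; apply: (@intr_inj R); rewrite e.
by case: ifP => // _; case: ifP.
Qed.

(** Triangles that are not connected have equal or opposite functionals, hence equal or opposite
    stars, and these share the apex [p1]. *)
Lemma star_pair_trichotomy (m n : nat) (w : 'I_m -> 'I_m -> 'I_n -> 'I_n -> int)
  (T1 T2 : triple n) p1 O1 I1 p2 O2 I2 :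
  (forall u v x y, w v u x y = - w u v x y) ->
  (forall u v x y, w u v y x = - w u v x y) ->
  (forall s t, is_cycle s -> is_cycle t -> `|cyc (fun u v => cyc (w u v) t) s| <= 1) ->
  uniq T1 -> uniq T2 -> ordered_partition p1 O1 I1 -> ordered_partition p2 O2 I2 ->
  star_form (link_form w T1) p1 O1 I1 -> star_form (link_form w T2) p2 O2 I2 ->
  ~ common_apex (star p1 O1 I1) (star p2 O2 I2) -> mutually_oriented p1 O1 p2 O2 ->
  [\/ exists p3, C1 p1 O1 I1 p2 O2 I2 p3, exists p3, C2 p1 O1 I1 p2 O2 I2 p3
    | exists p3, C3 p1 O1 I1 p2 O2 I2 p3].
Proof.
move=> wl wr weak u1 u2 h1 h2 s1 s2 hn mo.
have lN T u v : link_form w T v u = - link_form w T u v by exact: link_formN.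
have [[X [XN hX]]|e|e] := triangles_connected wl wr weak u1 u2.
- apply: (star_pair_cases h1 h2 hn mo XN) => s us ss sT.
  have := hX s us ss sT.
  by rewrite (star_form_cyc s (lN T1) h1 s1) (star_form_cyc s (lN T2) h2 s2).
- exfalso; apply: hn; exists p1, O1, I1, O1, I1; split; [exact: h1|exact: h1|by []|].
  by apply: (star_form_inj _ h2 h1 s2 s1) => u v; rewrite e.
exfalso; apply: hn; exists p1, O1, I1, I1, O1.
split; [exact: h1|exact: ordered_partitionC|by []|].
exact: (star_form_inj e h2 (ordered_partitionC h1) s2 (star_formN h1 s1)).
Qed.

Lemma link_form_flip (m n : nat) (w : 'I_m -> 'I_m -> 'I_n -> 'I_n -> int)
  (T : triple n) p O I :
  (forall u v x y, w u v y x = - w u v x y) -> ordered_partition p O I ->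
  star_form (link_form w T) p O I -> star_form (link_form w (flip T)) p I O.
Proof.
move=> wr h hs T' uT'; rewrite -(star_formN h hs uT'); apply: eq_cyc => u v.
by move: T {hs}; apply: triple_eta => a b c; rewrite flipE; exact: link_form_rev.
Qed.

Theorem theorem5p3 (R : realType) (m n : nat) (hm : (5 <= m)%N) (hn : (0 < n)%N)
  (f : 'rV[R]_m -> 'rV[R]_3) (g : 'rV[R]_n -> 'rV[R]_3)
  (hdisj : disjointly_embedded f g) (hweak : weakly_linked f g)
  (T1 T2 : triple n) (hT1 : uniq T1) (hT2 : uniq T2)
  (p1 p2 : 'I_m) (O1 I1 O2 I2 : {set 'I_m})
  (hpart1 : ordered_partition p1 O1 I1) (hpart2 : ordered_partition p2 O2 I2)
  (hlink1 : links_in_star (cycle_curve g T1) f (star p1 O1 I1))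
  (hlink2 : links_in_star (cycle_curve g T2) f (star p2 O2 I2))
  (hapex : ~ common_apex (star p1 O1 I1) (star p2 O2 I2)) :
  exists b1 b2 : bool,
    let T1' := if b1 then flip T1 else T1 in
    let O1' := if b1 then I1 else O1 in
    let I1' := if b1 then O1 else I1 in
    let T2' := if b2 then flip T2 else T2 in
    let O2' := if b2 then I2 else O2 in
    let I2' := if b2 then O2 else I2 in
    [/\ links_in_star (cycle_curve g T1') f (star p1 O1' I1'),
        links_in_star (cycle_curve g T2') f (star p2 O2' I2'),
        mutually_oriented p1 O1' p2 O2',
        exactly_one (exists p3, C1 p1 O1' I1' p2 O2' I2' p3)
                    (exists p3, C2 p1 O1' I1' p2 O2' I2' p3)
                    (exists p3, C3 p1 O1' I1' p2 O2' I2' p3)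
      & forall p3 : 'I_m,
          let Tstar := [set p1; p2; p3]%SET in
          let U := unoriented (star p1 O1' I1' :|: star p2 O2' I2')%SET in
          (C1 p1 O1' I1' p2 O2' I2' p3 \/ C2 p1 O1' I1' p2 O2' I2' p3 ->
             U = triangles_sharing_edge Tstar)
          /\ (C3 p1 O1' I1' p2 O2' I2' p3 ->
             U = (triangles_sharing_edge Tstar :\ Tstar)%SET)].
Proof.
(* The two vertices are only tips for the cones; any choice would do. *)
have [w [wl wr wE]] := linking_form p1 (tnth T1 ord0) hdisj.
have weak s t : is_cycle s -> is_cycle t -> `|cyc (fun u v => cyc (w u v) t) s| <= 1.
  move=> hs ht; have := hweak.2 s t hs ht.
  have [s0 t0] : (0 < size s)%N /\ (0 < size t)%N.
    by move: hs ht => /andP[_ /ltnW/ltnW ->] /andP[_ /ltnW/ltnW ->].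
  rewrite /strongly_linked wE // -intr_norm => /negP.
  by rewrite -ltNge -[2]/(2%:~R) ltr_int; lia.
have linkP T p O I := @links_in_starP R m n f g w T p O I wE.
(* [T1] is flipped exactly when [p2] lies in [I1], and [T2] when [p1] lies in [I2]; a flip affects
   only its own star, so the choices are independent. *)
pose b1 := p2 \notin O1; pose b2 := p1 \notin O2; exists b1, b2 => /=.
set T1' := if b1 then _ else _; set T2' := if b2 then flip T2 else T2.
have [p12 _ _ _] := no_common_apex hpart1 hpart2 hapex.
have u1 : uniq T1' by rewrite /T1'; case: (b1); rewrite //= rev_uniq.
have u2 : uniq T2' by rewrite /T2'; case: (b2); rewrite //= rev_uniq.
have mo : mutually_oriented p1 (if b1 then I1 else O1) p2 (if b2 then I2 else O2).
  have [_ hI1 _ _] := partitionP hpart1; have [_ hI2 _ _] := partitionP hpart2.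
  split => //.
    by rewrite /b2; have [h|/negPn//] := boolP (p1 \notin O2); rewrite hI2 h p12.
  by rewrite /b1; have [h|/negPn//] := boolP (p2 \notin O1); rewrite hI1 h eq_sym p12.
have apex : ~ common_apex (star p1 (if b1 then I1 else O1) (if b1 then O1 else I1))
                          (star p2 (if b2 then I2 else O2) (if b2 then O2 else I2)).
  move=> h; apply: hapex; move: h; case: (b1); case: (b2) => // h.
  - exact/common_apex_flip/common_apexC/common_apex_flip/common_apexC.
  - exact/common_apex_flip.
  - exact/common_apexC/common_apex_flip/common_apexC.
have P1 : ordered_partition p1 (if b1 then I1 else O1) (if b1 then O1 else I1).
  by case: (b1) => //; exact: ordered_partitionC.
have P2 : ordered_partition p2 (if b2 then I2 else O2) (if b2 then O2 else I2).
  by case: (b2) => //; exact: ordered_partitionC.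
have S1 : star_form (link_form w T1') p1 (if b1 then I1 else O1) (if b1 then O1 else I1).
  move/linkP: hlink1 => h; rewrite /T1'.
  by case: (b1); [exact: link_form_flip wr hpart1 h|exact: h].
have S2 : star_form (link_form w T2') p2 (if b2 then I2 else O2) (if b2 then O2 else I2).
  move/linkP: hlink2 => h; rewrite /T2'.
  by case: (b2); [exact: link_form_flip wr hpart2 h|exact: h].
split; [exact/linkP|exact/linkP|exact: mo| |].
  apply: (exactly_one_case hm P1 P2).
  exact: (star_pair_trichotomy wl wr weak u1 u2 P1 P2 S1 S2 apex mo).
move=> p3; split=> [[|]|].
- exact: union_C1 P1 P2 mo.
- exact: union_C2 P1 P2 mo.
exact: union_C3 P1 P2 mo.
Qed.
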